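(* Let $n\ge 2$ be even and $r\ge 1$, let $V=\{1,\dots,n\}$, $R=\{n+1,\dots,n+r\}$, $V^R=V\cup R$. Let $A^R=(a_{ij})_{i,j\in V^R}$ be a skew-symmetric complex matrix whose column sums are zero (equivalently, $\sum_{j\in V^R}a_{ij}=0$ for every $i\in V^R$), and let $A=(a_{ij})_{i,j\in V}$ be the matrix obtained from $A^R$ by deleting its last $r$ rows and columns. Let $G^R$ and $G$ be the graphs associated to $A^R$ and $A$ (see context). Then for every perfect matching $M_0$ of $G$, $$\mathrm{Pf}(A)=\sum_{F\in \mathcal{F}(M_0)}\mathrm{sgn}\big(\sigma_{M_0(F\setminus M_0)}\big)\prod_{e\in F\setminus M_0}a_e,$$ where $\mathcal{F}(M_0)$ is the set of spanning forests of $G^R$ compatible with $M_0$ satisfying Condition (C), $a_e=a_{uv}$ for the oriented edge $e=(u,v)$, and $\sigma_{M_0(F\setminus M_0)}$ is the permutation defined in the context.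
   Context: Pfaffian: $\mathrm{Pf}(A)=\frac{1}{2^{n/2}(n/2)!}\sum_{\sigma\in S_n}\mathrm{sgn}(\sigma)a_{\sigma(1)\sigma(2)}\cdots a_{\sigma(n-1)\sigma(n)}$. The graph $G^R$ has vertex set $V^R$ and an (undirected) edge $ij$ whenever $a_{ij}\neq 0$; $G$ is the analogous graph on $V$ built from $A$. A perfect matching of $G$ is a set of edges of $G$ such that each vertex of $V$ lies in exactly one of them. A spanning forest of $G^R$ is a set $F$ of oriented edges of $G^R$ containing no cycle such that each vertex of $V$ has exactly one outgoing edge in $F$ and vertices of $R$ have none; thus every connected component is a tree containing exactly one vertex of $R$ (its root), with edges oriented towards the root. A leaf is a vertex of $V$ with no incoming edge. $F$ is compatible with a perfect matching $M_0$ of $G$ if (forgetting orientations) $F$ contains all $n/2$ edges of $M_0$ (its other $n/2$ edges are then not in $M_0$); $F\setminus M_0$ denotes the oriented edges of $F$ not in $M_0$. Sign: the orientation of $F$ orients each edge of $M_0$; write the oriented matching edges as $(i_1,i_2),(i_3,i_4),\dots,(i_{n-1},i_n)$ (in any order of the pairs); $\sigma_{M_0(F\setminus M_0)}$ is the permutation $k\mapsto i_k$ of $\{1,\dots,n\}$ (its sign does not depend on the order of the pairs). Trimming algorithm, applied to a spanning forest $F$ compatible with $M_0$: set $F_1=F$. At step $i\ge1$, let $\ell^i$ be the leaf of $F_i$ (vertex of $V$ having an outgoing edge in $F_i$ and no incoming edge in $F_i$) with the largest label. Follow the unique directed path in $F_i$ from $\ell^i$ towards the root of its component, stopping at the first vertex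 reached which is either a vertex of $R$, or a fork (a vertex with more than one incoming edge in $F_i$), or a vertex with label smaller than $\ell^i$. This gives a path $\lambda_{\ell^i}$ of length $\ge1$. Set $F_{i+1}=F_i\setminus\lambda_{\ell^i}$; stop when $F_{i+1}$ is empty, say after $N$ steps. Condition (C): each of the paths $\lambda_{\ell^1},\dots,\lambda_{\ell^N}$ has even length and its first edge is an edge of $M_0$. *)

(* Defs.v *)
From HB Require Import structures.
From mathcomp Require Import all_boot all_order all_algebra all_fingroup.
Set Implicit Arguments. Unset Strict Implicit. Unset Printing Implicit Defensive.
Import Order.TTheory GRing.Theory Num.Theory.
Local Open Scope ring_scope.

Lemma pf_lt1 m (k : 'I_(m./2)) : (k.*2 < m)%N.
Proof.
have := ltn_ord k; rewrite -(leq_double k.+1) doubleS => h.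
apply: leq_trans (ltnW h) _; rewrite -[X in (_ <= X)%N](odd_double_half m).
exact: leq_addl.
Qed.

Lemma pf_lt2 m (k : 'I_(m./2)) : (k.*2.+1 < m)%N.
Proof.
have := ltn_ord k; rewrite -(leq_double k.+1) doubleS => h.
apply: leq_trans h _; rewrite -[X in (_ <= X)%N](odd_double_half m).
exact: leq_addl.
Qed.

Definition pfaffian (K : fieldType) (m : nat) (A : 'M[K]_m) : K :=
  ((2 ^ m./2 * (m./2)`!)%N%:R)^-1 *
  \sum_(s : 'S_m) (-1) ^+ s *
     \prod_(k < m./2) A (s (Ordinal (pf_lt1 k))) (s (Ordinal (pf_lt2 k))).

(* ---------- Graph / forest notions on V^R = 'I_(n+r) ---------------------
   Vertex i : 'I_(n+r) stands for the paper's vertex i+1;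
   V = {i | i < n}, R = {i | n <= i}. Labels are compared as naturals. *)
Section Forests.
Variables (K : fieldType) (n r : nat) (AR : 'M[K]_(n + r)).
Local Notation T := 'I_(n + r).

Definition inV (v : T) : bool := (v < n)%N.
Definition inR (v : T) : bool := (n <= v)%N.

(* edge ij of G^R (and of G when i, j are in V) *)
Definition adj (i j : T) : bool := (i != j) && (AR i j != 0).

Definition perfect_matching (M : {set {set T}}) : bool :=
  [forall e in M, exists i, exists j,
      [&& e == [set i; j], inV i, inV j & adj i j]] &&
  [forall v, inV v ==> (#|[set e in M | v \in e]| == 1%N)].

Definition out_edges (F : {set T * T}) (v : T) := [set p in F | p.1 == v].
Definition in_edges (F : {set T * T}) (v : T) := [set p in F | p.2 == v].

Definition acyclic (F : {set T * T}) : bool :=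
  [forall p in F, ~~ connect [rel u v | (u, v) \in F] p.2 p.1].

(* spanning forest of G^R rooted in R, edges oriented towards the roots *)
Definition spanning_forest (F : {set T * T}) : bool :=
  [&& [forall p in F, adj p.1 p.2],
      [forall v, if inV v then #|out_edges F v| == 1%N
                 else #|out_edges F v| == 0%N] &
      acyclic F].

Definition in_M (M : {set {set T}}) (p : T * T) : bool := [set p.1; p.2] \in M.

Definition compatible (M : {set {set T}}) (F : {set T * T}) : bool :=
  [forall e in M, exists p in F, [set p.1; p.2] == e].

(* sigma_{M0(F\M0)} : k |-> i_k where (i1,i2),(i3,i4),... are the matching
   edges oriented by F (listed in the enumeration order); extended by the
   identity on R, which does not change its sign. *)
Definition match_seq (M : {set {set T}}) (F : {set T * T}) : seq T :=
  flatten [seq [:: p.1; p.2] | p <- enum [set p in F | in_M M p]].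

Definition sigma_fun (M : {set {set T}}) (F : {set T * T}) (x : T) : T :=
  if inV x then nth x (match_seq M F) x else x.

(* sign of that permutation (0 if sigma_fun were not a permutation,
   which never happens for compatible spanning forests) *)
Definition sgn_sigma (M : {set {set T}}) (F : {set T * T}) : K :=
  oapp (fun s : {perm T} => (-1) ^+ s) 0
       [pick s : {perm T} | [forall x, s x == sigma_fun M F x]].

Definition is_leaf (F : {set T * T}) (v : T) : bool :=
  [&& inV v, #|out_edges F v| != 0%N & #|in_edges F v| == 0%N].

Definition top_leaf (F : {set T * T}) : option T :=
  [pick v | is_leaf F v && [forall w, is_leaf F w ==> (val w <= val v)%N]].

Fixpoint follow (F : {set T * T}) (l : T) (fuel : nat) (x : T) : seq (T * T) :=
  match fuel with
  | 0 => [::]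
  | fuel'.+1 =>
    match [pick p in F | p.1 == x] with
    | None => [::]
    | Some p =>
      if [|| inR p.2, (1 < #|in_edges F p.2|)%N | (val p.2 < val l)%N]
      then [:: p]
      else p :: follow F l fuel' p.2
    end
  end.

Fixpoint trim (F : {set T * T}) (fuel : nat) : option (seq (seq (T * T))) :=
  if F == set0 then Some [::] else
  match fuel with
  | 0 => None
  | fuel'.+1 =>
    match top_leaf F with
    | None => None
    | Some l =>
      let lam := follow F l #|T| l in
      omap (cons lam) (trim (F :\: [set p in lam]) fuel')
    end
  end.

Definition condC (M : {set {set T}}) (F : {set T * T}) : bool :=
  match trim F #|T| with
  | None => false
  | Some ps =>
    all (fun lam => ~~ odd (size lam) &&
                    (if lam is p :: _ then in_M M p else false)) ps
  end.

End Forests.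

(* Main.v *)
Require Import Defs.
From HB Require Import structures.
From mathcomp Require Import all_boot all_order all_algebra all_fingroup ring.
Set Implicit Arguments. Unset Strict Implicit. Unset Printing Implicit Defensive.
Import Order.TTheory GRing.Theory Num.Theory.
Local Open Scope ring_scope.

(* Trimming is undone path by path: the last path trimmed runs from the
   smallest vertex to a root, the one before it from the smallest remaining
   vertex to the roots or the last path, and so on. Condition (C) says that
   along each of these paths the edges lie alternately in M0 and outside,
   starting in M0. Hence the forests are exactly the successful runs of an
   exploration which from a vertex c goes to its mate u and then to any vertex
   t not on the current path.

   The Pfaffian obeys the same recursion. Replace the rows of the vertices of
   the current path P by their sum b and let U be the set of unvisited vertices
   other than u. Expanding Pf(b, u, U) along u produces the entry of u and b,
   which by the zero row sums equals minus the sum of a_ut over the t outside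
   P. If t belongs to a finished path or is a root, the path stops and Pf(U)
   remains; if t is in U, the terms in a_ut add up to the Pfaffian with b
   replaced by b + t, and the row of u may be added as well because its
   contribution is a Pfaffian with a repeated row. So b + u + t takes the role
   of b, as in the exploration. *)

(** * Alternating sums over the entries of a list *)

Section AlternatingSums.
Variables (C : numFieldType) (T : eqType).
Implicit Types (F G : T -> seq T -> C) (h : seq T -> C) (s p q : seq T).

(** The sum of [(-1)^i * F t r] over the positions [i] of [s], with [t] the entry at [i] and [r] the
    list without it: the shape of an expansion along a row. *)
Fixpoint altsum F s : C :=
  if s is z :: s' then F z s' - altsum (fun t r => F t (z :: r)) s' else 0.

Definition swapping h :=
  forall p x y q, h (p ++ x :: y :: q) = - h (p ++ y :: x :: q).

Lemma eq_altsum F G s :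
  (forall t r, F t r = G t r) -> altsum F s = altsum G s.
Proof.
elim: s F G => //= z s IH F G eqFG; rewrite eqFG; congr (_ - _).
exact: IH.
Qed.

Lemma altsumD F G s :
  altsum (fun t r => F t r + G t r) s = altsum F s + altsum G s.
Proof.
by elim: s F G => [|z s IH] F G /=; rewrite ?addr0 // IH; ring.
Qed.

Lemma altsumZ c F s : altsum (fun t r => c * F t r) s = c * altsum F s.
Proof.
by elim: s F => [|z s IH] F /=; rewrite ?mulr0 // IH; ring.
Qed.

Lemma altsumN F s : altsum (fun t r => - F t r) s = - altsum F s.
Proof.
by elim: s F => [|z s IH] F /=; rewrite ?oppr0 // IH; ring.
Qed.

Lemma altsum0 s : altsum (fun _ _ => 0) s = 0.
Proof. by elim: s => //= z s ->; rewrite subr0. Qed.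

(** Two entries can be removed in either order, leaving the same list. The sign differs, because
    removing the earlier one first shifts the position of the other by one. *)
Lemma altsum_exchange (H : T -> T -> seq T -> C) s :
  altsum (fun x r => altsum (fun y q => H x y q) r) s
  = - altsum (fun x r => altsum (fun y q => H y x q) r) s.
Proof.
elim: s H => [|z s IH] H /=; first by rewrite oppr0.
have E (K : T -> T -> seq T -> C) :
    altsum (fun t r => K t z r - altsum (fun y q => K t y (z :: q)) r) s
    = altsum (fun t r => K t z r) s
      - altsum (fun t r => altsum (fun y q => K t y (z :: q)) r) s.
  by rewrite altsumD altsumN.
by rewrite (E H) (E (fun x y => H y x)) (IH (fun x y q => H x y (z :: q))); ring.
Qed.

(** Terms removing another entry change sign by hypothesis; the two terms removing [x] or [y] trade
    places, and their positions have opposite parity. *)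
Lemma altsum_swapping F : (forall t, swapping (F t)) -> swapping (altsum F).
Proof.
move=> swF p x y q; elim: p F swF => [|z p IH] F swF /=.
  have -> : altsum (fun t r => F t [:: x, y & r]) q
          = - altsum (fun t r => F t [:: y, x & r]) q.
    by rewrite -altsumN; apply: eq_altsum => t r; apply: (swF t [::]).
  by ring.
rewrite swF (IH (fun t r => F t (z :: r))) => [|t p' x' y' q']; first by ring.
exact: (swF t (z :: p')).
Qed.

Lemma swapping_cat h p : swapping h -> swapping (fun r => h (p ++ r)).
Proof. by move=> swh p' x y q; rewrite !catA; apply: swh. Qed.

(** Moving [t] from its position to the front costs exactly the sign that [altsum] attaches to
    it. *)
Lemma altsum_front (g : T -> C) h s : swapping h ->
  altsum (fun t r => g t * h (t :: r)) s = (\sum_(t <- s) g t) * h s.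
Proof.
elim: s h => [|z s IH] h swh /=; first by rewrite big_nil mul0r.
rewrite big_cons mulrDl; congr (_ + _); rewrite -altsumN.
rewrite -(IH (fun r => h (z :: r))); last exact: (swapping_cat [:: z]).
by apply: eq_altsum => t r; rewrite (swh [::]) mulrN opprK.
Qed.

(** The sign of a position is absorbed by [h] when the entry moves to the front, which leaves a
    plain sum. Uniqueness makes [rem t s] remove the intended occurrence. *)
Lemma mul_altsum h F s : swapping h -> uniq s ->
  h s * altsum F s = \sum_(t <- s) h (t :: rem t s) * F t (rem t s).
Proof.
elim: s h F => [|z s IH] h F swh /=; first by rewrite big_nil mulr0.
case/andP => zs us; rewrite big_cons eqxx mulrBr; congr (_ + _).
rewrite (IH (fun r => h (z :: r))) //; last exact: (swapping_cat [:: z]).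
rewrite -sumrN; apply: eq_big_seq => t ts.
have -> : (z == t) = false by apply: contraNF zs => /eqP ->.
by rewrite [in RHS](swh [::]) mulNr.
Qed.

Lemma adjacent_perm (X : Type) (k : seq T -> X) s s' :
  (forall p x y q, k (p ++ x :: y :: q) = k (p ++ y :: x :: q)) ->
  perm_eq s s' -> k s = k s'.
Proof.
pose inv (k : seq T -> X) :=
  forall p x y q, k (p ++ x :: y :: q) = k (p ++ y :: x :: q).
rewrite -/(inv k); elim: s s' k => [|x s IH] s' k ik.
  by move/perm_size/esym/size0nil => ->.
have front p q : k (p ++ x :: q) = k (x :: p ++ q).
  elim: p k ik => //= z p IHp k ik.
  rewrite (IHp (fun r => k (z :: r))) => [|p' x' y' q']; last exact: (ik (z :: p')).
  exact: (ik [::]).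
move=> ps; have xs' : x \in s' by rewrite -(perm_mem ps) mem_head.
case/splitPr: xs' ps => p q; rewrite perm_sym perm_catC /= perm_cons perm_sym => ps.
rewrite front //; have /= -> // := IH (p ++ q) (fun r => k (x :: r)).
  by move=> p' x' y' q'; apply: (ik (x :: p')).
by rewrite perm_sym perm_catC perm_sym.
Qed.

(** Signs cancel in a product of two alternating functions, so a sign and a Pfaffian can be
    reordered together without computing any parity. *)
Lemma swapping_perm h1 h2 s s' : swapping h1 -> swapping h2 ->
  perm_eq s s' -> h1 s * h2 s = h1 s' * h2 s'.
Proof.
move=> sw1 sw2; apply: (@adjacent_perm _ (fun r => h1 r * h2 r)) => p x y q.
by rewrite sw1 sw2 mulrNN.
Qed.

End AlternatingSums.

(** * Pfaffians of lists, expanded along the first entry *)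

Section ListPfaffian.
Variables (C : numFieldType) (T : eqType) (a : T -> T -> C).

(* [pf k s] is [0] unless [size s = k.*2]: with the fuel separate from [s], it
   is alternating without any size condition. *)
Fixpoint pf (k : nat) (s : seq T) : C :=
  if k is k'.+1 then
    if s is x :: s' then altsum (fun y r => a x y * pf k' r) s' else 0
  else (s == [::])%:R.

(* The first entry of the list is replaced by a row [rho] that need not be a
   row of [a]. *)
Definition pfrow (rho : T -> C) k s := altsum (fun y r => rho y * pf k r) s.

Hypothesis askew : forall x y, a x y = - a y x.

(** A swap behind the first entry is a case of [altsum_swapping]. For the first two entries,
    expanding along both gives a double sum that is antisymmetric by [altsum_exchange]; the
    remaining term, pairing [x] with [y], changes sign since [a] is skew. *)
Lemma pf_swapping k : swapping (pf k).
Proof.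
elim: k => [|k IH] [|z p] x y q /=; rewrite ?oppr0 //; last first.
  by apply: altsum_swapping => t p' x' y' q'; rewrite IH mulrN.
rewrite askew mulNr opprD; congr (_ + _); rewrite opprK.
case: k {IH} => [|k] /=.
  have z w : altsum (fun t r => a w t * 0) q = 0.
    by rewrite -[RHS](altsum0 _ q); apply: eq_altsum => t r; rewrite mulr0.
  by rewrite !z oppr0.
transitivity (- altsum (fun t r => altsum (fun y0 q0 => a x t * (a y y0 * pf k q0)) r) q).
  by congr (- _); apply: eq_altsum => t r; rewrite altsumZ.
rewrite altsum_exchange opprK; apply: eq_altsum => t r.
by rewrite -altsumZ; apply: eq_altsum => t' r'; ring.
Qed.

Lemma pfrow_swapping rho k : swapping (pfrow rho k).
Proof.
by apply: altsum_swapping => t p x y q; rewrite pf_swapping mulrN.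
Qed.

(** A Pfaffian with a repeated row: the summand is symmetric in the two removed entries, so by
    [altsum_exchange] the double sum is its own opposite, and 2 is invertible. *)
Lemma pfrow_double u k s :
  altsum (fun t r => a u t * pfrow (a u) k r) s = 0.
Proof.
have E : forall s, altsum (fun t r => a u t * pfrow (a u) k r) s
   = altsum (fun t r => altsum (fun y q => a u t * (a u y * pf k q)) r) s.
  by move=> s'; apply: eq_altsum => t r; rewrite altsumZ.
apply/eqP; rewrite -[_ == 0](mulrn_eq0 _ 2) mulr2n {2}E altsum_exchange E.
rewrite subr_eq0; apply/eqP; apply: eq_altsum => t r.
by apply: eq_altsum => t' r'; ring.
Qed.

(* Expanding along [u], the row [rho] may be enlarged by the rows of [u] and of
   the next vertex [t]: the latter restores the terms [a u t * pf k s], the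
   former contributes [0] as [u] is then repeated. *)
Lemma pfrow_cons rho k u s : size s = k.*2 ->
  pfrow rho k (u :: s) = (rho u - \sum_(t <- s) a u t) * pf k s
   + altsum (fun t r => a u t * pfrow (fun y => rho y + a u y + a t y) k.-1 r) s.
Proof.
case: k => [|k] size_s; rewrite /pfrow /=.
  by rewrite (size0nil size_s) /= big_nil; ring.
(* Expanding along [rho] and then [u], or along [u] and then [rho], differs by a sign. *)
have E : altsum (fun t r => rho t * altsum (fun y q => a u y * pf k q) r) s
  = - altsum (fun t r => a u t * pfrow rho k r) s.
  transitivity (altsum (fun t r => altsum (fun y q => rho t * (a u y * pf k q)) r) s).
    by apply: eq_altsum => t r; rewrite altsumZ.
  rewrite altsum_exchange; congr (- _); apply: eq_altsum => t r.
  by rewrite -altsumZ; apply: eq_altsum => t' r'; ring.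
(* Turning the product with the sum of [a u t] into an alternating sum puts [t] in front, and [pf]
   of [t :: r] is [pfrow] for the row of [t]. *)
rewrite E opprK mulrBl -(altsum_front (a u) s (@pf_swapping k.+1)) /=.
have -> : altsum (fun t r => a u t *
             altsum (fun y q => (rho y + a u y + a t y) * pf k q) r) s
  = altsum (fun t r => a u t * pfrow rho k r) s
    + altsum (fun t r => a u t * pfrow (a u) k r) s
    + altsum (fun t r => a u t * pfrow (a t) k r) s.
  rewrite -!altsumD; apply: eq_altsum => t r.
  rewrite -!mulrDr -!altsumD; congr (_ * _); apply: eq_altsum => t' r'; ring.
by rewrite pfrow_double /pfrow; ring.
Qed.

End ListPfaffian.

Lemma altsum_map (C : numFieldType) (S T : eqType) (h : S -> T)
    (F : T -> seq T -> C) s :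
  altsum F (map h s) = altsum (fun x r => F (h x) (map h r)) s.
Proof. by elim: s F => //= z s IH F; rewrite IH. Qed.

Lemma eq_pf (C : numFieldType) (T : eqType) (a b : T -> T -> C) k s :
  (forall x y, a x y = b x y) -> pf a k s = pf b k s.
Proof.
move=> eq_ab; elim: k s => [|k IH] [|x s] //=.
by apply: eq_altsum => y r; rewrite eq_ab IH.
Qed.

Lemma pf_map (C : numFieldType) (S T : eqType) (h : S -> T)
    (a : T -> T -> C) k s :
  pf a k (map h s) = pf (fun x y => a (h x) (h y)) k s.
Proof.
elim: k s => [|k IH] [|x s] //=; rewrite altsum_map.
by apply: eq_altsum => y r; rewrite IH.
Qed.

(** * Signs of lists as determinants of permutation matrices *)

Section ListSign.
Variables (C : numFieldType) (m : nat).
Implicit Types (l : seq 'I_m) (s : 'S_m).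

(* Junk value [0] when [l] is not a permutation of [enum 'I_m]. *)
Definition lsgn l : C :=
  (size l == m)%:R * \det (\matrix_(i < m, j < m) (onth l i == Some j)%:R).

(** The swap exchanges two rows of the matrix, those at the positions [size p] and [(size p).+1]. *)
Lemma lsgn_swapping : swapping lsgn.
Proof.
move=> p x y q; rewrite /lsgn !size_cat /=.
case: eqP => [size_m|_]; last by rewrite !mul0r oppr0.
have lt1 : (size p < m)%N by rewrite -[ltnRHS]size_m -[ltnLHS]addn0 ltn_add2l.
have lt2 : ((size p).+1 < m)%N by rewrite -[ltnRHS]size_m -addn1 ltn_add2l.
pose i1 := Ordinal lt1; pose i2 := Ordinal lt2.
set A := (X in _ = - (_ * \det X)).
have -> : \matrix_(i < m, j < m) (onth (p ++ x :: y :: q) i == Some j)%:R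
        = row_perm (tperm i1 i2) A :> 'M[C]_m.
  apply/matrixP => i j; rewrite !mxE !onth_cat; case: tpermP => [->|->|] /=.
  - by rewrite ltnn ltnNge leqnSn subnn subSnn.
  - by rewrite ltnn ltnNge leqnSn subnn subSnn.
  move=> /eqP; rewrite -val_eqE /= => n1 /eqP; rewrite -val_eqE /= => n2.
  case: ltnP => // le; rewrite -(subnKC le) in n1 n2 *.
  move: n1 n2; rewrite addKn -[X in _ != X]addn0 -[X in _ != X.+1]addn0 -addnS.
  by rewrite !eqn_add2l; case: (i - size p)%N => [|[]].
rewrite row_permE det_mulmx det_perm odd_tperm.
have -> : i1 != i2 by rewrite -val_eqE /= neq_ltn ltnSn.
by rewrite mulN1r mulrN.
Qed.

Lemma lsgn_perm s : lsgn (map s (enum 'I_m)) = (-1) ^+ s.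
Proof.
rewrite /lsgn size_map size_enum_ord eqxx mul1r -det_perm; congr (\det _).
apply/matrixP => i j; rewrite !mxE onth_map onthE (nth_map i) ?size_enum_ord //.
by rewrite nth_ord_enum.
Qed.

End ListSign.

(** * The sum over permutations and the recursive expansion *)

Section PfaffianSum.
Variable C : numFieldType.

Fixpoint pairprod (T : Type) (a : T -> T -> C) (l : seq T) : C :=
  if l is x :: y :: l' then a x y * pairprod a l' else 1.

Lemma pairprod_prod (T : Type) (a : T -> T -> C) x0 l :
  pairprod a l = \prod_(k < (size l)./2) a (nth x0 l k.*2) (nth x0 l k.*2.+1).
Proof.
have [n] := ubnP (size l); elim: n l => // n IH [|x [|y l]] /= lt_n;
  rewrite ?big_ord0 // big_ord_recl; congr (_ * _).
by rewrite IH //; move: lt_n; rewrite !ltnS; apply: ltnW.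
Qed.

(** Every first entry [x] contributes the same amount: moving [x] to the front keeps the product of
    [h] and the Pfaffian, and summing over the second entry [y] expands the Pfaffian along [x]. The
    [k.+1.*2] choices of [x] account for the growth of the constant. *)
Lemma sum_permutations (T : eqType) (a : T -> T -> C) (h : seq T -> C) k u :
  (forall x y, a x y = - a y x) -> swapping h -> uniq u -> size u = k.*2 ->
  \sum_(l <- permutations u) h l * pairprod a l
  = (2 ^ k * k`!)%N%:R * h u * pf a k u.
Proof.
move=> askew; elim: k h u => [|k IH] h u swh uu szu.
  rewrite (size0nil szu) /= -[permutations _]/[:: [::]] big_seq1 /=.
  by rewrite !mulr1 mul1r.
have sz_rem (x : T) (v : seq T) n : x \in v -> size v = n.+1 -> size (rem x v) = n.
  by move=> xv szv; rewrite size_rem // szv.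
have step (v : seq T) : size v != 0 -> perm_eq (permutations v)
    [seq x :: t | x <- undup v, t <- permutations (rem x v)].
  by rewrite -lt0n; apply: permutationsE.
rewrite (perm_big _ (step u _)); last by rewrite szu.
rewrite undup_id // big_allpairs_dep.
transitivity (\sum_(x <- u) (2 ^ k * k`!)%N%:R * (h u * pf a k.+1 u)); last first.
  rewrite big_const_seq count_predT iter_addr_0 szu -[LHS]mulr_natr expnS factS.
  by rewrite -muln2 !natrM; ring.
apply: eq_big_seq => x xu; have uur := rem_uniq x uu.
have szr := sz_rem _ _ _ xu szu.
rewrite (perm_big _ (step (rem x u) _)) ?szr // undup_id // big_allpairs_dep.
rewrite (swapping_perm swh (pf_swapping askew k.+1) (perm_to_rem xu)).
rewrite /= (mul_altsum _ (swapping_cat [:: x] swh)) //= big_distrr /=.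
apply: eq_big_seq => y yr; have szrr := sz_rem _ _ _ yr szr.
transitivity (a x y * \sum_(l <- permutations (rem y (rem x u)))
                 h ([:: x; y] ++ l) * pairprod a l).
  by rewrite big_distrr /=; apply: eq_bigr => l _; ring.
rewrite (IH (fun l => h ([:: x; y] ++ l))) ?rem_uniq //; first by ring.
exact: swapping_cat.
Qed.

Lemma pfaffian_pf n (B : 'M[C]_n) : ~~ odd n ->
  (forall i j, B i j = - B j i) ->
  pfaffian B = pf (fun i j => B i j) n./2 (enum 'I_n).
Proof.
move=> even_n Bskew; rewrite /pfaffian.
have [k def_n] : exists k, n = k.*2.
  by exists n./2; rewrite -[LHS]odd_double_half (negbTE even_n).
have halfn : n./2 = k by rewrite def_n doubleK.
pose g l := lsgn C l * pairprod (fun i j => B i j) l.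
have -> : \sum_(s : 'S_n) (-1) ^+ s *
      \prod_(k < n./2) B (s (Ordinal (pf_lt1 k))) (s (Ordinal (pf_lt2 k)))
    = \sum_(s : 'S_n) g (map s (enum 'I_n)).
  apply: eq_bigr => s _; rewrite /g lsgn_perm; congr (_ * _).
  (* [nth] needs a default entry; if ['I_n] is empty, both products are empty. *)
  case: (pickP 'I_n) => [x0 _|none]; last first.
    rewrite big1 => [|k0 _]; last by have := none (Ordinal (pf_lt1 k0)).
    by case: (enum 'I_n) => [|x l] //; have := none x.
  rewrite (pairprod_prod _ x0) size_map size_enum_ord; apply: eq_bigr => i _.
  rewrite !(nth_map x0) -?enumT ?size_enum_ord ?pf_lt1 ?pf_lt2 //.
  by congr (B (s _) (s _)); apply: val_inj => /=; rewrite -?enumT nth_enum_ord ?pf_lt1 ?pf_lt2.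
rewrite -big_enum -(big_map (fun s : 'S_n => map s (enum 'I_n)) predT g) /=.
(* Listing the values of a permutation is a bijection onto the rearrangements of [enum 'I_n]. *)
rewrite (perm_big (permutations (enum 'I_n))) /=; last first.
  apply: uniq_perm => [||l]; rewrite ?permutations_uniq //.
    rewrite map_inj_uniq ?enum_uniq // => s t /eq_in_map est.
    by apply/permP => i; apply: est; rewrite mem_enum.
  rewrite mem_permutations; apply/mapP/(@tuple_permP _ _ l (ord_tuple n)).
    case=> s _ ->; exists s => /=.
    by apply: eq_map => i; rewrite tnth_ord_tuple.
  case=> s ->; exists s; rewrite ?mem_enum // /=.
  by apply: eq_map => i; rewrite tnth_ord_tuple.
rewrite (sum_permutations (k := k)) ?enum_uniq ?size_enum_ord ?halfn //;
  last exact: lsgn_swapping.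
have -> : lsgn C (enum 'I_n) = 1.
  have := lsgn_perm C (1%g : 'S_n); rewrite odd_perm1 expr0 => <-.
  by rewrite -{1}[enum 'I_n]map_id; congr lsgn; apply: eq_map => i; rewrite perm1.
rewrite mulr1 mulrA mulVf ?mul1r // pnatr_eq0 -lt0n.
by rewrite muln_gt0 expn_gt0 fact_gt0.
Qed.

End PfaffianSum.

(** * Summing weights over the successful explorations *)

Section Exploration.
Variables (C : numFieldType) (T : finType) (V : pred T) (mate : T -> T).
Variables (a : T -> T -> C) (h : seq T -> C).
Hypothesis mateV : forall v, V v -> V (mate v).
Hypothesis mate_neq : forall v, V v -> mate v != v.
Hypothesis mateK : forall v, V v -> mate (mate v) = v.
Hypothesis askew : forall x y, a x y = - a y x.
Hypothesis row_sum0 : forall x, \sum_y a x y = 0.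
Hypothesis swh : swapping h.

(* The paths of a forest [f] are uncovered in the order opposite to trimming:
   the current path has reached [c], the set [D] holds the roots and the
   vertices of the finished paths, and [s] lists the vertices not visited yet.
   *)
Fixpoint explore k (f : T -> T) (D : {set T}) c s : bool :=
  if k is k'.+1 then
    let u := mate c in let s' := rem u s in
    (f c == u) &&
    (if f u \in D then
       if s' is m :: s'' then explore k' f [set x | x \notin s'] m s'' else true
     else (f u \in s') && explore k' f D (f u) (rem (f u) s'))
  else false.

Definition pairs (tl : seq T) : seq T := flatten [seq [:: v; mate v] | v <- tl].

Definition tail_of (f : T -> T) v := V v && (f v == mate v).

(** [f] sends a vertex to the head of its outgoing edge and [h] stands for the sign. If each
    matching edge has exactly one end satisfying [tail_of], the edges outside the matching are those
    leaving the mates of these ends. *)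
Definition weight (f : T -> T) : C :=
  h (pairs (enum (tail_of f))) * \prod_(v | tail_of f v) a (mate v) (f (mate v)).

(** [explore] constrains [f] only on the vertices it visits; prescribing all other values makes each
    run count once in a sum over [f]. *)
Definition agree_off (s : seq T) (f f0 : T -> T) :=
  [forall x, (x \in s) || (f x == f0 x)].

Lemma agree_offP s f f0 :
  reflect (forall x, x \notin s -> f x = f0 x) (agree_off s f f0).
Proof.
apply: (iffP forallP) => H x; first by move=> xs; have := H x; rewrite (negbTE xs) => /eqP.
by case: (boolP (x \in s)) => //= /H ->.
Qed.

Lemma pairs_rcons tl c : pairs (rcons tl c) = pairs tl ++ [:: c; mate c].
Proof. by rewrite /pairs map_rcons flatten_rcons. Qed.

Lemma mem_pairs tl v : (v \in pairs tl) = (v \in tl) || (v \in map mate tl).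
Proof.
by elim: tl => //= x tl IH; rewrite !inE IH -!orbA; congr orb; rewrite orbCA.
Qed.

Lemma perm_pairs tl tl' : perm_eq tl tl' -> perm_eq (pairs tl) (pairs tl').
Proof. by move=> p; apply/perm_flatten/perm_map. Qed.

Lemma pairs_mate tl v : {subset pairs tl <= V} ->
  v \in pairs tl -> mate v \in pairs tl.
Proof.
move=> tlV vt; have := tlV v vt; move: vt; rewrite !mem_pairs.
case/orP => [vt _|/mapP[x xt ->] _]; first by rewrite map_f ?orbT.
by rewrite mateK ?xt //; apply: tlV; rewrite mem_pairs xt.
Qed.

(** Exchanging two adjacent blocks of length two takes four adjacent swaps. *)
Lemma pairs_block tl tl' : perm_eq tl tl' -> h (pairs tl) = h (pairs tl').
Proof.
apply: (@adjacent_perm _ _ (fun r => h (pairs r))) => p x y q.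
rewrite /pairs !map_cat !flatten_cat /=; set r := flatten _; set r' := flatten _.
have sw w x1 x2 w' : h (r ++ w ++ x1 :: x2 :: w') = - h (r ++ w ++ x2 :: x1 :: w').
  by rewrite !catA swh.
rewrite (sw [:: x]) (sw [::]) (sw [:: y; x]) /= (sw [:: y]) /= !opprK.
by [].
Qed.

Lemma pairs_uniq tl : uniq (pairs tl) -> uniq tl.
Proof.
elim: tl => //= x tl IH /and3P[]; rewrite !inE negb_or => /andP[_ xtl] _ /IH ->.
by rewrite andbT; apply: contra xtl => xtl; rewrite mem_pairs xtl.
Qed.

(** The tails of [f] are exactly [tl]: any other vertex of [V] is the mate of some [x] in [tl], and
    [f] does not send it back to [x]. *)
Lemma weight_full (f : T -> T) tl :
  uniq (pairs tl) -> pairs tl =i V ->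
  (forall v, v \in tl -> f v = mate v /\ f (mate v) != v) ->
  weight f = h (pairs tl) * \prod_(v <- tl) a (mate v) (f (mate v)).
Proof.
move=> utl tlV ftl.
have tailE : tail_of f =i tl.
  move=> v; rewrite -[LHS]/(tail_of f v) /tail_of -[V v]/(v \in V) -tlV mem_pairs.
  case: (boolP (v \in tl)) => /= [/ftl[-> _]|ntl]; first by rewrite eqxx.
  apply/negbTE/negP => /andP[/mapP[x xt ->]].
  have xV : V x by rewrite -[V x]/(x \in V) -tlV mem_pairs xt.
  by rewrite mateK // => /eqP fx; have [_] := ftl x xt; rewrite fx eqxx.
have penum : perm_eq (enum (tail_of f)) tl.
  by apply: uniq_perm (enum_uniq _) (pairs_uniq utl) _ => v; rewrite mem_enum tailE.
rewrite /weight (pairs_block penum); congr (_ * _).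
by rewrite -(perm_big _ penum) /= big_enum.
Qed.

(** Here [tl] holds the matching tails already passed, and the last product the weights of the edges
    leaving their mates. In the exploration, the vertices outside [D] and [s] form the current path,
    whose rows are added up. With [u] the mate of [c], the sum is split by the value [t] of [f u],
    and the parts are compared with [pfrow_cons]. *)
Lemma explore_sum k (f0 : {ffun T -> T}) tl (D : {set T}) c s :
  uniq (pairs tl ++ c :: s) -> pairs tl ++ c :: s =i V ->
  {in D, forall x, x \notin c :: s} -> size s = k.*2.+1 ->
  (forall v, v \in tl -> f0 v = mate v /\ f0 (mate v) != v) ->
  \sum_(f : {ffun T -> T} | agree_off (c :: s) f f0 && explore k.+1 f D c s)
     weight f
  = h (pairs tl ++ c :: s)
    * pfrow a (fun y => \sum_(p | (p \notin D) && (p \notin s)) a p y) k s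
    * \prod_(v <- tl) a (mate v) (f0 (mate v)).
Proof.
elim/ltn_ind: k f0 tl D c s => k IH f0 tl D c s us sV Ds szs ftl.
have tlV : {subset pairs tl <= V} by move=> v vt; rewrite -sV mem_cat vt.
have cV : V c by rewrite -[V c]/(c \in V) -sV mem_cat mem_head orbT.
have cs : c \notin s by move: us; rewrite cat_uniq => /and3P[_ _ /andP[]].
set u := mate c; set s' := rem u s.
have uc : u != c by apply: mate_neq.
(* The visited pairs are closed under [mate], so if they contained [u] they would also contain
   [c]. *)
have u_s : u \in s.
  have: u \in pairs tl ++ c :: s by rewrite sV; apply: mateV.
  rewrite mem_cat inE (negbTE uc) /= => /orP[/(pairs_mate tlV)|//].
  rewrite mateK // => ct; move: us; rewrite cat_uniq => /and3P[_ /hasPn].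
  by move=> /(_ c); rewrite mem_head /= ct => /(_ isT).
have uss : uniq s by move: us; rewrite cat_uniq => /and3P[_ _ /andP[]].
have us' : uniq s' by rewrite rem_uniq.
have s'E x : (x \in s') = (x != u) && (x \in s) by rewrite mem_rem_uniq.
have szs' : size s' = k.*2 by rewrite size_rem // szs.
have permL : perm_eq (pairs (rcons tl c) ++ s') (pairs tl ++ c :: s).
  rewrite pairs_rcons -catA perm_cat2l /= perm_cons perm_sym.
  exact: perm_to_rem.
(* The prescribed values after one round of exploration, to be used as [f0] in the induction
   hypothesis. *)
pose f1 t : {ffun T -> T} :=
  [ffun x => if x == c then u else if x == u then t else f0 x].
pose Pi := \prod_(v <- tl) a (mate v) (f0 (mate v)).
have cpt : c \notin pairs tl.
  by apply/negP => ct; move: us; rewrite cat_uniq /= => /and3P[_ /norP[/negP]].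
have upt : u \notin pairs tl.
  apply/negP => ut; move: us; rewrite cat_uniq => /and3P[_ /hasPn/(_ u)].
  by rewrite inE u_s orbT /= ut => /(_ isT).
have tl_ct v : v \in tl -> [/\ v != c, v != u, mate v != c & mate v != u].
  move=> vt; have vp : v \in pairs tl by rewrite mem_pairs vt.
  have mvp : mate v \in pairs tl by apply: pairs_mate.
  by split; [apply: contraNneq cpt|apply: contraNneq upt|
             apply: contraNneq cpt|apply: contraNneq upt] => <-.
have prod_f1 t : \prod_(v <- rcons tl c) a (mate v) (f1 t (mate v)) = a u t * Pi.
  rewrite -cats1 big_cat big_seq1 /= -/u ffunE (negbTE uc) eqxx mulrC.
  congr (_ * _); apply: eq_big_seq => v /tl_ct[_ _ vc vu].
  by rewrite ffunE (negbTE vc) (negbTE vu).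
have f1_tl t : t != c -> forall v, v \in rcons tl c ->
    f1 t v = mate v /\ f1 t (mate v) != v.
  move=> tc v; rewrite mem_rcons inE !ffunE => /orP[/eqP->|vt].
    by rewrite eqxx -/u (negbTE uc) eqxx.
  by have [/negbTE-> /negbTE-> /negbTE-> /negbTE->] := tl_ct v vt; apply: ftl.
have cs' : c \notin s' by rewrite s'E (negbTE cs) andbF.
have us'n : u \notin s' by rewrite s'E eqxx.
have agreeE t (f : {ffun T -> T}) :
    [&& agree_off (c :: s) f f0, f c == u & f u == t] = agree_off s' f (f1 t).
  apply/and3P/agree_offP => [[/agree_offP H /eqP fc /eqP fu] x xs'|H].
    rewrite ffunE; case: eqP => [-> //|/eqP xc]; case: eqP => [-> //|/eqP xu].
    by apply: H; move: xs'; rewrite s'E xu inE negb_or xc.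
  split; rewrite ?H // ?ffunE ?eqxx ?(negbTE uc) ?eqxx //.
  apply/agree_offP => x; rewrite inE negb_or => /andP[xc xs].
  rewrite H ?s'E ?(negbTE xs) ?andbF // ffunE (negbTE xc).
  by case: eqP => // xu; rewrite xu u_s in xs.
pose sumt t := \sum_(f : {ffun T -> T} |
   agree_off (c :: s) f f0 && explore k.+1 f D c s && (f u == t)) weight f.
have sumE t : sumt t = \sum_(f : {ffun T -> T} | agree_off s' f (f1 t) &&
    (if t \in D then if s' is m :: s'' then explore k f [set x | x \notin s'] m s''
                      else true
     else (t \in s') && explore k f D t (rem t s'))) weight f.
  apply: eq_bigl => f; rewrite -agreeE /= -/u -/s'.
  by case: (f u =P t) => [->|_]; rewrite ?andbT ?andbF //= -!andbA.
have permL_uniq : uniq (pairs (rcons tl c) ++ s') by rewrite (perm_uniq permL).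
have permL_V : pairs (rcons tl c) ++ s' =i V.
  by move=> x; rewrite (perm_mem permL) sV.
(* The path stops at [t]. Either [s'] is empty and [f1 t] is the only function left, or a new path
   starts at the head [m] of [s'], and the added row is that of [m] alone. *)
have sumD t : t \in D -> sumt t = h (pairs (rcons tl c) ++ s') * pf a k s' * (a u t * Pi).
  move=> tD; rewrite sumE tD.
  have tc : t != c by apply: contraNneq (Ds t tD) => ->; apply: mem_head.
  case: k IH szs' {sumE sumt szs} => [|k] IH szs'.
    rewrite (size0nil szs') in permL_uniq permL_V agreeE *.
    rewrite (big_pred1 (f1 t)) => [|f]; last first.
      rewrite andbT; apply/agree_offP/eqP => [H|-> //].
      by apply/ffunP => x; apply: H.
    rewrite cats0 in permL_uniq permL_V *.
    by rewrite (weight_full permL_uniq permL_V (f1_tl t tc)) prod_f1 mulr1.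
  case def_s': s' szs' => [|m s''] // [szs''].
  rewrite (IH k _ _ (rcons tl c)) //; last exact: f1_tl; rewrite -?def_s' //; last 1 first.
    by move=> x; rewrite inE.
  rewrite prod_f1; congr (_ * _ * _); rewrite /pfrow /= [in RHS]def_s' /=.
  apply: eq_altsum => y r; congr (_ * _).
  rewrite (big_pred1 m) // => p; rewrite inE negbK def_s' inE /=.
  case: (p =P m) => [->|_] /=; last by case: (p \in s'').
  by move: us'; rewrite def_s' => /= /andP[].
(* The path goes on to [t], so the rows of [u] and [t] join the added row. *)
have sums' t : t \in s' -> sumt t = h (pairs (rcons tl c) ++ t :: rem t s')
   * pfrow a (fun y => \sum_(p | (p \notin D) && (p \notin s)) a p y + a u y + a t y)
        k.-1 (rem t s') * (a u t * Pi).
  move=> ts'; rewrite sumE.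
  have ts : t \in s by move: ts'; rewrite s'E => /andP[].
  have tD : t \notin D by apply: contraL ts => /Ds; rewrite inE negb_or => /andP[].
  have tc : t != c by apply: contraNneq cs => <-.
  have pt := perm_to_rem ts'.
  rewrite (negbTE tD) ts' /=.
  case: k IH szs' {sumD sumE sumt szs} => [|k] IH szs'.
    by rewrite (size0nil szs') in ts'.
  have permt : perm_eq (pairs (rcons tl c) ++ t :: rem t s') (pairs (rcons tl c) ++ s').
    by rewrite perm_cat2l perm_sym.
  have -> : \sum_(f : {ffun T -> T} | agree_off s' f (f1 t)
                 && explore k.+1 f D t (rem t s')) weight f
          = \sum_(f : {ffun T -> T} | agree_off (t :: rem t s') f (f1 t)
                 && explore k.+1 f D t (rem t s')) weight f.
    apply: eq_bigl => f; congr (_ && _).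
    by apply: eq_forallb => x; rewrite (perm_mem pt).
  rewrite (IH k _ _ (rcons tl c)) //; first 1 last.
  - by rewrite (perm_uniq permt).
  - by move=> x; rewrite (perm_mem permt).
  - move=> x xD; rewrite -(perm_mem pt) s'E; apply/nandP; right.
    by have := Ds x xD; rewrite inE negb_or => /andP[].
  - by rewrite size_rem // szs'.
  - exact: f1_tl.
  rewrite prod_f1; congr (_ * _ * _); apply: eq_altsum => y r; congr (_ * _).
  rewrite (bigD1 u) /=; last first.
    rewrite (contraTN (@Ds u)) ?inE ?u_s ?orbT //.
    by rewrite mem_rem_uniq // inE s'E eqxx andbF.
  rewrite (bigD1 t) /=; last first.
    rewrite tD mem_rem_uniq // inE eqxx /=.
    by apply: contraNneq us'n => <-.
  rewrite -addrA [RHS]addrC -addrA; congr (_ + (_ + _)); apply: eq_bigl => p.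
  rewrite mem_rem_uniq // inE s'E.
  case: (p == t) / eqP => [->|_]; first by rewrite ts !andbF.
  by case: (p == u) / eqP => [->|_]; rewrite ?u_s !(andbT, andbF).
(* Such a [t] lies on the current path, [u] included, and the run fails. *)
have sum0 t : t \notin D -> t \notin s' -> sumt t = 0.
  move=> tD ts'; rewrite sumE big_pred0 // => f.
  by rewrite (negbTE tD) (negbTE ts') andbF.
rewrite (partition_big (fun f : {ffun T -> T} => f u) predT) //=.
transitivity (\sum_(t in D) sumt t + \sum_(t <- s') sumt t).
  rewrite (big_uniq _ us') (bigID [in D]) /=; congr (_ + _).
  rewrite (bigID [in s']) /= addrC big1 ?add0r => [|t /andP[]]; last exact: sum0.
  apply: eq_bigl => t; apply: andb_idl => ts'; apply: contraL (ts') => /Ds.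
  by rewrite s'E inE negb_or => /andP[_ /negbTE ->]; rewrite andbF.
have -> : \sum_(t in D) sumt t
    = (\sum_(t in D) a u t) * (h (pairs (rcons tl c) ++ s') * pf a k s') * Pi.
  rewrite !mulr_suml; apply: eq_bigr => t tD; rewrite sumD //; ring.
rewrite (eq_big_seq _ sums').
set rho := (fun y => \sum_(p | (p \notin D) && (p \notin s)) a p y).
(* Both factors alternate, so [u] can be moved to the front of [s] in both at once. *)
have -> : h (pairs tl ++ c :: s) * pfrow a rho k s
        = h (pairs (rcons tl c) ++ s') * pfrow a rho k (u :: s').
  rewrite -[c :: s]cat1s catA pairs_rcons.
  have -> : (pairs tl ++ [:: c; u]) ++ s' = (pairs tl ++ [:: c]) ++ u :: s'.
    by rewrite -!catA.
  apply: (@swapping_perm _ _ (fun r => h ((pairs tl ++ [:: c]) ++ r))).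
  - exact: swapping_cat.
  - exact: pfrow_swapping.
  - exact: perm_to_rem.
(* The first term of [pfrow_cons] collects the [t] in [D]: as the row of [u] sums to zero, the sum
   of [a u t] over [D] is [rho u] minus the sum over [s']. *)
rewrite pfrow_cons // mulrDr mulrDl; congr (_ * _ + _).
  rewrite mulrCA; congr (_ * _).
  have /(_ u) := row_sum0; rewrite (bigID [in D]) /=.
  rewrite (bigID [in s] (fun t => t \notin D)) /=.
  have -> : \sum_(t | (t \notin D) && (t \in s)) a u t = \sum_(t <- s') a u t.
    rewrite (big_uniq _ us') /= (bigD1 u) /=; last first.
      by rewrite u_s andbT; apply: contraTN (u_s) => /Ds; rewrite inE negb_or => /andP[].
    have /eqP -> : a u u == 0 by rewrite -[_ == 0](mulrn_eq0 _ 2) mulr2n {2}askew subrr.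
    rewrite add0r; apply: eq_bigl => t; rewrite s'E andbC; congr (_ && _).
    apply: andb_idl => ts; apply: contraL (ts) => /Ds.
    by rewrite inE negb_or => /andP[].
  have -> : \sum_(t | (t \notin D) && (t \notin s)) a u t = - rho u.
    by rewrite /rho -sumrN; apply: eq_bigr => p _; apply: askew.
  by rewrite addrA => /eqP; rewrite subr_eq0 => /eqP <-; rewrite addrK.
rewrite (mul_altsum _ (swapping_cat (pairs (rcons tl c)) swh)) //.
by rewrite mulr_suml; apply: eq_bigr => t _; rewrite /rho /Pi /=; ring.
Qed.

End Exploration.

(** * Trimming recovers the list of paths *)

Section Decomposition.
Variables (n r : nat).
Local Notation T := 'I_(n + r).
Variable f : T -> T.
Implicit Types (g : seq T) (gs : seq (seq T)) (x y u v w c m : T).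

Definition starts_below m g := if g is x :: _ then (x < m)%N else false.

(* Characterizes the list of the trimmed paths, in trimming order. *)
Fixpoint good gs : bool :=
  if gs is g :: gs' then
    (if g is m :: q then
       [&& path (frel f) m q, all (fun y => (m <= y)%N) q,
           all (starts_below m) gs' &
           inR (f (last m q)) || (f (last m q) \in flatten gs')]
     else false)
    && [&& uniq (g ++ flatten gs'), all (@inV n r) g & good gs']
  else true.

Definition edge_set (S : seq T) : {set T * T} :=
  [set p | (p.1 \in S) && (p.2 == f p.1)].

Definition edges g : seq (T * T) := [seq (v, f v) | v <- g].

Lemma mem_edges g u v : ((u, v) \in edges g) = (u \in g) && (v == f u).
Proof.
apply/mapP/andP => [[w wg [-> ->]]|[ug /eqP ->]]; last by exists u.
by rewrite wg eqxx.
Qed.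

Lemma inRE v : inR v = ~~ inV v.
Proof. by rewrite /inR /inV -leqNgt. Qed.

Lemma flatten_cons (S : Type) (s : seq S) ss : flatten (s :: ss) = s ++ flatten ss.
Proof. by []. Qed.

Lemma good_cat gs1 gs2 : good (gs1 ++ gs2) -> good gs2.
Proof. by elim: gs1 => //= g gs1 IH /and4P[_ _ _ /IH]. Qed.

Lemma good_uniq gs : good gs -> uniq (flatten gs).
Proof. by case: gs => //= g gs /and4P[]. Qed.

Lemma good_inV gs v : good gs -> v \in flatten gs -> inV v.
Proof.
elim: gs => //= g gs IH /and4P[_ _ /allP gV /IH {}IH].
by rewrite mem_cat => /orP[/gV|/IH].
Qed.

Lemma path_next m q u : path (frel f) m q -> u \in m :: q ->
  u = last m q \/ f u \in q.
Proof.
elim: q m => [|y q IH] m /=; first by rewrite inE => _ /eqP ->; left.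
case/andP=> /eqP <- /IH {}IH; rewrite inE => /orP[/eqP ->|/IH[->|]].
- by right; apply: mem_head.
- by left.
- by move=> fu; right; rewrite inE fu orbT.
Qed.

Lemma path_prev m q v : path (frel f) m q -> v \in q ->
  exists2 u, u \in m :: q & f u = v.
Proof.
elim: q m => //= y q IH m /andP[/eqP fm /IH {}IH].
rewrite inE => /orP[/eqP ->|/IH[u uq fu]]; first by exists m; rewrite ?mem_head.
by exists u; rewrite // inE uq orbT.
Qed.

Lemma path_index m q u : path (frel f) m q -> uniq (m :: q) -> u \in m :: q ->
  u != last m q -> index (f u) (m :: q) = (index u (m :: q)).+1.
Proof.
elim: q m => [|y q IH] m /=; first by rewrite inE => _ _ ->.
case/andP=> /eqP fm pq /andP[mq uq]; rewrite inE [m == u]eq_sym.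
case: (u =P m) => [-> _ _|_ /= uyq ul].
  by rewrite fm eqxx; case: eqP mq => // ->; rewrite mem_head.
case: (path_next pq uyq) => [ull|fuq]; first by rewrite ull eqxx in ul.
have -> : (m == f u) = false.
  by apply: contraNF mq => /eqP ->; rewrite inE fuq orbT.
by rewrite -(IH y).
Qed.

Lemma good_step gs v : good gs -> v \in flatten gs ->
  inR (f v) || (f v \in flatten gs).
Proof.
elim: gs => //= -[|m q] gs IH //= /andP[/and4P[pq _ _ e] /and3P[_ _ /IH {}IH]].
rewrite -cat_cons mem_cat [f v \in _]inE mem_cat => /orP[vg|/IH/orP[->//|->]].
  case: (path_next pq vg) => [->|->]; last by rewrite !orbT.
  by case/orP: e => [->//|->]; rewrite !orbT.
by rewrite !orbT.
Qed.

(** A vertex that is not the start of its path has its predecessor on that path. *)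
Lemma good_leaf gs w : good gs -> w \in flatten gs ->
  (forall u, u \in flatten gs -> f u != w) -> exists q, w :: q \in gs.
Proof.
elim: gs => //= -[|m q] gs IH //= /andP[/and4P[pq _ _ e] /and3P[_ _ /IH {}IH]].
rewrite -cat_cons mem_cat => /orP[wg|wgs] no_pred; last first.
  have [|q' wq'] := IH wgs; last by exists q'; rewrite inE wq' orbT.
  by move=> u ugs; apply: no_pred; rewrite mem_cat ugs orbT.
move: wg; rewrite inE => /orP[/eqP ->|wq]; first by exists q; rewrite mem_head.
have [u uq fu] := path_prev pq wq.
by have := no_pred u; rewrite mem_cat uq fu eqxx => /(_ isT).
Qed.

Lemma good_last m q gs : good ((m :: q) :: gs) -> f (last m q) \notin m :: q.
Proof.
case/andP=> /and4P[_ _ _ e] /and3P[us gV _]; apply/negP => fl.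
move: e; rewrite inRE (allP gV) //= => fgs.
by move: us; rewrite cat_uniq => /and3P[_ /hasPn/(_ _ fgs)]; rewrite /= fl.
Qed.

(** Each path runs forward and leaves for a later path or a root, so edges increase the position;
    the [index] of a root is the size of the list. Acyclicity follows. *)
Lemma good_index gs v : good gs -> v \in flatten gs ->
  (index v (flatten gs) < index (f v) (flatten gs))%N.
Proof.
elim: gs => // -[|m q] gs IH // gd; have fl := good_last gd.
have us := good_uniq gd; case/and3P: (gd) => /and4P[pq _ _ _] _ /andP[gV gd'].
rewrite flatten_cons in us *; rewrite mem_cat !index_cat.
have uq : uniq (m :: q) by move: us; rewrite cat_uniq => /and3P[].
case: (boolP (v \in m :: q)) => [vg _|vg vgs].
  case: (boolP (f v \in m :: q)) => [fvg|_]; last by rewrite ltn_addr // index_mem.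
  by rewrite path_index //; apply: contraNneq fl => <-.
have fvg : f v \notin m :: q.
  apply/negP => fvg; have fV := allP gV _ fvg.
  have := good_step gd' vgs; rewrite inRE fV => /= fvgs.
  by move: us; rewrite cat_uniq => /and3P[_ /hasPn/(_ _ fvgs)]; rewrite /= fvg.
by rewrite (negbTE fvg) ltn_add2l IH.
Qed.

Lemma edge_set_index gs : good gs -> {in edge_set (flatten gs), forall p,
  ~~ connect [rel u v | (u, v) \in edge_set (flatten gs)] p.2 p.1}.
Proof.
move=> gd [u v]; rewrite inE => /andP[/= us /eqP ->]; apply/negP => /connectP[p].
have lt_u := good_index gd us.
elim: p (f u) lt_u => [|y p IH] x lt_u /=; first by move=> _ e; rewrite e ltnn in lt_u.
rewrite inE => /andP[/andP[/= xs /eqP ->] pp]; apply: IH => //.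
exact: ltn_trans lt_u (good_index gd xs).
Qed.

(** Later paths lead only to later paths and roots, so the first path is entered by no edge from
    outside. *)
Lemma good_pred m q gs u : good ((m :: q) :: gs) ->
  u \in flatten ((m :: q) :: gs) -> f u \in m :: q ->
  u \in m :: q /\ index (f u) (m :: q) = (index u (m :: q)).+1.
Proof.
move=> gd; have fl := good_last gd; have us := good_uniq gd.
case/and3P: gd => /and4P[pq _ _ _] _ /andP[/allP gV gd'].
rewrite flatten_cons mem_cat in us * => uS fuq.
have uq : uniq (m :: q) by move: us; rewrite cat_uniq => /and3P[].
case/orP: uS => [ug|ugs].
  by split=> //; rewrite path_index //; apply: contraNneq fl => <-.
have := good_step gd' ugs; rewrite inRE gV //= => fugs.
by move: us; rewrite cat_uniq => /and3P[_ /hasPn/(_ _ fugs)]; rewrite /= fuq.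
Qed.

(** Inside the first path no stopping rule applies: its vertices lie in [V], are at least [m], and
    are no forks by [good_pred]. *)
Lemma follow_edges m q gs : good ((m :: q) :: gs) ->
  follow (edge_set (flatten ((m :: q) :: gs))) m #|T| m = edges (m :: q).
Proof.
move=> gd; set F := edge_set _.
have us := good_uniq gd.
case/and3P: (gd) => /and4P[pq /allP minm /allP st e] _ /andP[/allP gV gd'].
rewrite flatten_cons in us F *.
have uq : uniq (m :: q) by move: us; rewrite cat_uniq => /and3P[].
have inF u v : ((u, v) \in F) = (u \in (m :: q) ++ flatten gs) && (v == f u).
  by rewrite inE.
suff gen k x q1 q2 : m :: q = q1 ++ x :: q2 -> (size (x :: q2) <= k)%N ->
    follow F m k x = edges (x :: q2).
  apply: (gen _ _ [::]) => //.
  by rewrite -(card_uniqP uq) max_card.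
elim: k x q1 q2 => // k IH x q1 q2 def_q le_k.
have xg : x \in m :: q by rewrite def_q mem_cat mem_head orbT.
have -> : follow F m k.+1 x =
   if [|| inR (f x), (1 < #|in_edges F (f x)|)%N | (val (f x) < val m)%N]
   then [:: (x, f x)] else (x, f x) :: follow F m k (f x).
  rewrite /=; case: pickP => [[u v]|/(_ (x, f x))] /=.
    by rewrite inF => /andP[/andP[_ /eqP ->] /eqP ->].
  by rewrite inF mem_cat xg !eqxx.
case: q2 def_q le_k => [|y q2] def_q le_k.
  (* At the end of the path one of the rules must apply. If [f x] is neither a root nor a fork, no
     edge of the later paths enters it; so it starts one of them by [good_leaf] and is smaller than
     [m]. *)
  have x_last : last m q = x by rewrite -[LHS]/(last m (m :: q)) def_q last_cat.
  case: ifP => //; rewrite x_last in e; case/norP; case/orP: e => [-> //|fxgs] _.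
  case/norP => /card_gt1P nfork; rewrite -leqNgt => le_m; exfalso.
  case: (pickP [pred u | (u \in flatten gs) && (f u == f x)])
    => [u /andP[/= ugs /eqP fu]|none].
    apply: nfork; exists (u, f x), (x, f x); rewrite !in_set /= fu !eqxx.
    rewrite -!cat_cons !mem_cat ugs xg !orbT; split=> //.
    apply: contraTneq ugs => -[->]; move: us; rewrite cat_uniq => /and3P[_ /hasPn h _].
    by apply/negP => /h; rewrite xg.
  have [u ugs|q' /st] := good_leaf gd' fxgs; last by rewrite /= ltnNge le_m.
  by have := none u; rewrite /= ugs => /= ->.
have fx : f x = y.
  move: pq; rewrite -[path _ _ _]/(sorted (frel f) (m :: q)) def_q.
  by rewrite sorted_cat_cons => /and3P[_ /eqP].
have yg : y \in m :: q by rewrite def_q mem_cat !inE eqxx !orbT.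
rewrite fx inRE gV //=.
have -> : (y < m)%N = false.
  by rewrite ltnNge; move: yg; rewrite inE => /orP[/eqP ->|/minm ->] //; rewrite leqnn.
have -> : (1 < #|in_edges F y|)%N = false.
  apply/card_gt1P => -[[u u'] [[v v'] []]].
  rewrite !inE /= => /andP[/andP[uS /eqP ->] /eqP fu] /andP[/andP[vS /eqP ->] /eqP fv].
  have [|ug iu] := good_pred gd uS; first by rewrite fu.
  have [|vg iv] := good_pred gd vS; first by rewrite fv.
  rewrite fu fv in iu iv *; case/negP; apply/eqP; congr pair.
  by apply: (index_inj m ug vg); apply: succn_inj; rewrite -iu -iv.
rewrite (IH _ (rcons q1 x) q2) ?cat_rcons //=; last by rewrite fx.
Qed.

Lemma leafP gs v : good gs ->
  reflect (v \in flatten gs /\ forall u, u \in flatten gs -> f u != v)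
          (is_leaf (edge_set (flatten gs)) v).
Proof.
move=> gd; apply: (iffP and3P) => [[_]|[vS no_pred]].
  rewrite !cards_eq0 => /set0Pn[[u w]]; rewrite !inE /= => /andP[/andP[uS _] /eqP uv].
  move/eqP/setP => no_in; split; first by rewrite -uv.
  move=> w' wS; have := no_in (w', f w'); rewrite !inE /= wS eqxx /= => ->.
  by [].
split; first exact: good_inV gd vS.
  by rewrite cards_eq0; apply/set0Pn; exists (v, f v); rewrite !inE /= vS !eqxx.
rewrite cards_eq0; apply/eqP/setP => -[u w]; rewrite !inE /=.
by apply/negP => /andP[/andP[uS /eqP ->]]; apply/negP; apply: no_pred.
Qed.

(** By [good_pred] no edge enters [m], which has index 0 in its path. Every other leaf starts a
    later path by [good_leaf], hence is smaller. *)
Lemma top_leaf_good m q gs : good ((m :: q) :: gs) ->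
  top_leaf (edge_set (flatten ((m :: q) :: gs))) = Some m.
Proof.
move=> gd; set F := edge_set _.
have m_leaf : is_leaf F m.
  apply/leafP => //; split; first by rewrite mem_head.
  move=> u uS; apply/negP => /eqP fu.
  by have [|_] := good_pred gd uS; rewrite fu ?mem_head //= eqxx.
have le_m w : is_leaf F w -> (w <= m)%N.
  case/leafP => // wS no_pred; have [q'] := good_leaf gd wS no_pred.
  case/and3P: gd => /and4P[_ _ /allP st _] _ _.
  by rewrite inE => /orP[/eqP[->]|/st /ltnW].
rewrite /top_leaf; case: pickP => [v /andP[v_leaf /forallP v_max]|/(_ m)].
  congr Some; apply/val_inj/eqP; rewrite eqn_leq le_m //=.
  by have := v_max m; rewrite m_leaf.
by rewrite m_leaf /=; case/negP; apply/forallP => w; apply/implyP/le_m.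
Qed.

Lemma trim_good gs k : good gs -> (size (flatten gs) <= k)%N ->
  trim (edge_set (flatten gs)) k = Some (map edges gs).
Proof.
elim: gs k => [|[|m q] gs IH] k gd //.
  have -> : edge_set (flatten [::]) = set0 by apply/setP => p; rewrite !inE.
  by case: k => [|k] _ /=; rewrite eqxx.
have nz : edge_set (flatten ((m :: q) :: gs)) == set0 = false.
  by apply/negP => /eqP/setP/(_ (m, f m)); rewrite !inE !eqxx.
case: k => // k; rewrite {1}flatten_cons size_cat => le_k.
rewrite [LHS]/= -[m :: q ++ flatten gs]/(flatten ((m :: q) :: gs)) nz.
rewrite top_leaf_good // follow_edges //.
have us := good_uniq gd; case/and3P: gd => _ _ /andP[_ gd'].
have -> : edge_set (flatten ((m :: q) :: gs)) :\: [set p in edges (m :: q)]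
          = edge_set (flatten gs).
  apply/setP => -[u v]; rewrite !in_set mem_edges flatten_cons mem_cat /=.
  case: (v == f u); rewrite ?andbF // !andbT; case: (boolP (u \in m :: q)) => //= ug.
  apply/esym/negP => ugs; move: us; rewrite flatten_cons cat_uniq.
  by case/and3P => _ /hasPn/(_ _ ugs); rewrite /= ug.
rewrite IH //.
by rewrite -ltnS (leq_trans _ le_k) // -[size (m :: q)]/(size q).+1 addSn ltnS leq_addl.
Qed.

End Decomposition.

(** * Decomposition into paths, and alternation along them *)

Section Alternation.
Variables (n r : nat).
Local Notation T := 'I_(n + r).
Variables (f mate : T -> T).
Implicit Types (g : seq T) (gs : seq (seq T)) (x y u v w c m : T).
Hypothesis mateV : forall v, inV v -> inV (mate v).
Hypothesis mate_neq : forall v, inV v -> mate v != v.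
Hypothesis mateK : forall v, inV v -> mate (mate v) = v.

(** Put in front of [gs] the path from the smallest uncovered vertex up to the first root or covered
    vertex, and repeat until [V] is covered. *)
Lemma good_extend gs : (forall v, exists k, inR (iter k f v)) ->
  good f gs ->
  (forall x, inV x -> x \notin flatten gs -> all (starts_below x) gs) ->
  exists2 gs', good f gs' & flatten gs' =i @inV n r.
Proof.
move=> reach; have [N] := ubnP #|[predC flatten gs]|.
elim: N gs => // N IH gs lt_N gd st.
case: (pickP [pred x : T | inV x && (x \notin flatten gs)]) => [x0 x0P|none]; last first.
  exists gs => // x; apply/idP/idP => [/(good_inV gd)//|xV].
  by have := none x; rewrite /= [inV x]xV /= => /negbFE.
case: (arg_minnP (fun x : T => val x) x0P) => m /andP[mV mgs] min_m.
have ex_stop : exists k, inR (iter k f m) || (iter k f m \in flatten gs).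
  by have [k kR] := reach m; exists k; rewrite kR.
case: (ex_minnP ex_stop) => -[|k] stop min_k.
  by move: stop; rewrite /= inRE mV (negbTE mgs).
have mem_g x : x \in traject f m k.+1 -> inV x && (x \notin flatten gs).
  case/trajectP => i lt_i ->; apply: contraLR lt_i; rewrite -leqNgt negb_and negbK -inRE.
  exact: min_k.
have last_g : last m (traject f (f m) k) = iter k f m by rewrite last_traject.
apply: (IH (traject f m k.+1 :: gs)).
- rewrite ltnS in lt_N; apply: leq_trans lt_N; apply: proper_card; apply/properP; split.
    apply/subsetP => x; apply: contra => xgs /=.
    by rewrite -cat_cons mem_cat xgs orbT.
  by exists m; [|rewrite negbK]; rewrite ?[_ \in [predC _]]mgs //= mem_head.
- rewrite [good _ _]/= gd fpath_traject last_g -iterS stop st // !andbT /=.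
  have -> /= : all (fun y => (m <= y)%N) (traject f (f m) k).
    by apply/allP => x xg; apply: min_m; apply: mem_g; rewrite inE xg orbT.
  have: all (@inV n r) (traject f m k.+1) by apply/allP => x /mem_g /andP[].
  move=> /= ->; rewrite andbT -[_ && _]/(uniq (traject f m k.+1 ++ flatten gs)).
  rewrite cat_uniq (good_uniq gd) andbT.
  (* If the path repeated a vertex, its stopping vertex [iter k.+1 f m] would lie on it, although no
     vertex of the path is covered or a root. *)
  rewrite looping_uniq; apply/andP; split; last first.
    by apply/hasPn => x xgs; apply/negP => /mem_g; rewrite xgs andbF.
  apply/negP => /loopingP/(_ k.+1) lo.
  have: iter k.+1 f m \in traject f m k.+1.
    by rewrite trajectSr mem_rcons inE lo orbT.
  by case/mem_g/andP; move: stop; rewrite inRE => /orP[/negbTE ->|->].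
- move=> x xV; rewrite -[flatten _]/(traject f m k.+1 ++ flatten gs) mem_cat => /norP[xg xgs].
  rewrite /= st // andbT ltn_neqAle min_m /=; last by rewrite [inV x]xV.
  by rewrite andbT; apply: contraNneq xg => e; rewrite inE -(val_inj e) eqxx.
Qed.

(** The list of a path omits its end point, so its size is the length of the path; alternation
    groups its vertices in matched pairs. *)
Fixpoint alt g := match g with
  | [::] => true
  | x :: y :: g' => (y == mate x) && alt g'
  | _ => false
  end.

Lemma alt_cat g1 g2 : alt g1 -> alt (g1 ++ g2) = alt g2.
Proof.
have [N] := ubnP (size g1); elim: N g1 => // N IH [|x [|y g1]] //= lt_N /andP[-> /IH -> //].
exact: ltnW lt_N.
Qed.

Lemma alt_odd g : alt g -> ~~ odd (size g).
Proof.
have [N] := ubnP (size g); elim: N g => // N IH [|x [|y g]] //= lt_N /andP[_ /IH].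
by rewrite negbK; apply; apply: ltnW lt_N.
Qed.

Lemma alt_mate g v : alt g -> all (@inV n r) g -> v \in g -> mate v \in g.
Proof.
have [N] := ubnP (size g); elim: N g => // N IH [|x [|y g]] //= lt_N.
case/andP=> /eqP -> altg /and3P[xV _ gV]; rewrite !inE => /or3P[/eqP ->|/eqP ->|vg].
- by rewrite eqxx orbT.
- by rewrite mateK // eqxx.
- by rewrite IH ?orbT //; apply: ltnW lt_N.
Qed.

Lemma flatten_mate gs v : all alt gs -> all (@inV n r) (flatten gs) ->
  v \in flatten gs -> mate v \in flatten gs.
Proof.
elim: gs => //= g gs IH /andP[altg altgs]; rewrite all_cat => /andP[gV gsV].
rewrite !mem_cat => /orP[/alt_mate -> //|/IH -> //]; exact: orbT.
Qed.

(** Scan the vertices in trimming order, those before [c] being closed under [mate]. If the matching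
    edge at [c] pointed into [c], its tail would precede [c] by [good_index], and closure would put
    [c] before itself. So [f c] is [mate c]. *)
Lemma good_alt gs : good f gs -> flatten gs =i @inV n r ->
  (forall v, inV v -> f v = mate v \/ f (mate v) = v) ->
  all (fun g => ~~ odd (size g)) gs -> all alt gs.
Proof.
move=> gd gsV compat even_gs.
have tail_mate X c Y : flatten gs = X ++ c :: Y ->
    (forall v, v \in X -> mate v \in X) -> f c = mate c.
  move=> def_gs mateX; have c_gs : c \in flatten gs by rewrite def_gs mem_cat mem_head orbT.
  have cV : inV c by apply: good_inV gd c_gs.
  have cX : c \notin X.
    apply/negP => cX; have := good_uniq gd; rewrite def_gs cat_uniq.
    by case/and3P => _ /hasPn/(_ c); rewrite mem_head /= cX => /(_ isT).
  case: (compat c cV) => // fw; set w := mate c in fw *.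
  have w_gs : w \in flatten gs by rewrite gsV; apply: mateV.
  have := good_index gd w_gs; rewrite fw def_gs !index_cat (negbTE cX) /= eqxx addn0.
  case: ifP => [/mateX|_]; last by rewrite ltnNge leq_addr.
  by rewrite mateK // (negbTE cX).
suff gen post rest : gs = post ++ rest -> all alt post -> all alt rest.
  exact: (gen [::]).
elim: rest post => // g rest IH post def_gs alt_post /=.
suff altg : alt g.
  by rewrite altg (IH (rcons post g)) ?cat_rcons // all_rcons altg alt_post.
suff gen2 p q : g = p ++ q -> alt p -> alt q by apply: (gen2 [::]).
have [N] := ubnP (size q); elim: N p q => // N IHN p q lt_N def_g alt_p.
case: q def_g lt_N => // c q def_g lt_N.
have all_p : all alt (rcons post p) by rewrite all_rcons alt_p.
have def_flat : flatten gs = flatten (rcons post p) ++ c :: q ++ flatten rest.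
  by rewrite def_gs def_g !flatten_cat /= flatten_rcons -!catA.
have fc : f c = mate c.
  apply: (tail_mate _ _ _ def_flat) => v; apply: flatten_mate => //.
  by apply/allP => x xX; apply: (good_inV gd); rewrite def_flat mem_cat xX.
(* If [c] were last, the size of [g] would be odd, since [p] is grouped in pairs. *)
case: q def_g lt_N {def_flat} => [|y q] def_g lt_N.
  have: g \in gs by rewrite def_gs mem_cat mem_head orbT.
  move/(allP even_gs); rewrite def_g size_cat addn1 /= negbK => op.
  by have := alt_odd alt_p; rewrite op.
have fcy : f c = y.
  have: sorted (frel f) g.
    have: good f (g :: rest) by move: gd; rewrite def_gs => /good_cat.
    by case: (g) => //= m q' /andP[/and4P[]].
  by rewrite def_g sorted_cat_cons => /and3P[_ /eqP].
rewrite /= -fcy fc eqxx /= (IHN (p ++ [:: c; y])) //.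
- exact: ltnW lt_N.
- by rewrite -catA.
- by rewrite alt_cat //= -fcy fc eqxx.
Qed.

(** * Explorations and alternating decompositions correspond *)

Local Notation ltv := (fun x y : T => (x < y)%N).

Lemma ltv_trans : transitive ltv.
Proof. by move=> y x z; apply: ltn_trans. Qed.

Lemma good_cons x0 g gs : g != [::] -> sorted (frel f) g ->
  all (fun y => (head x0 g <= y)%N) g -> all (starts_below (head x0 g)) gs ->
  inR (f (last x0 g)) || (f (last x0 g) \in flatten gs) ->
  uniq (g ++ flatten gs) -> all (@inV n r) g -> good f gs -> good f (g :: gs).
Proof.
case: g => // m q _ pq /andP[_ minm] st e us gV gd.
by apply/andP; split; apply/and4P || apply/and3P; split.
Qed.

(** [p] is the current path before [c], and [gs] are the finished paths. The start of the current
    path is [head c p], which is [c] if [p] is empty. It stays below all of [s] and above the starts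
    of [gs], as [good] requires once the complete path is put in front of [gs]. *)
Lemma explore_good k p c s gs (D : {set T}) :
  explore mate k f D c s -> good f gs -> all alt gs ->
  (forall x, (x \in D) = inR x || (x \in flatten gs)) ->
  sorted (frel f) (rcons p c) -> alt p ->
  perm_eq (rcons p c ++ s ++ flatten gs) (enum (@inV n r)) ->
  all (fun y => (head c p <= y)%N) (rcons p c) ->
  all (fun y => (head c p < y)%N) s ->
  all (starts_below (head c p)) gs -> sorted ltv s ->
  exists gs', [/\ good f gs', all alt gs' & flatten gs' =i @inV n r].
Proof.
elim: k p c s gs D => //= k IH p c s gs D /andP[/eqP fc ex] gd altgs DE pathp altp.
move=> permV min_p min_s st sort_s; set u := mate c in fc ex; set s' := rem u s in ex.
have us : uniq (rcons p c ++ s ++ flatten gs) by rewrite (perm_uniq permV) enum_uniq.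
have memV x : inV x = (x \in rcons p c ++ s ++ flatten gs).
  by rewrite (perm_mem permV) mem_enum.
have cV : inV c by rewrite memV mem_cat mem_rcons mem_head.
have pV : all (@inV n r) p.
  by apply/allP => x xp; rewrite memV mem_cat mem_rcons inE xp orbT.
have gsV : all (@inV n r) (flatten gs).
  by apply/allP => x xgs; apply: good_inV gd xgs.
have us_s : u \in s.
  have := memV u; rewrite mateV // !mem_cat mem_rcons inE (negbTE (mate_neq cV)) /=.
  case/esym/or3P => // [/(alt_mate altp pV)|/(flatten_mate altgs gsV)];
    rewrite mateK // => cin; move: us.
    by rewrite cat_uniq rcons_uniq cin.
  rewrite cat_uniq => /and3P[_ /hasPn/(_ c)].
  by rewrite mem_cat cin orbT mem_rcons mem_head => /(_ isT).
have permg : perm_eq ((p ++ [:: c; u]) ++ s' ++ flatten gs) (enum (@inV n r)).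
  apply: perm_trans permV; rewrite -cats1 -!catA perm_cat2l /= perm_cons.
  by rewrite -cat_cons perm_cat2r perm_sym perm_to_rem.
have usg : uniq ((p ++ [:: c; u]) ++ s' ++ flatten gs) by rewrite (perm_uniq permg) enum_uniq.
have memVg x : inV x = (x \in (p ++ [:: c; u]) ++ s' ++ flatten gs).
  by rewrite (perm_mem permg) mem_enum.
have sub_s : {subset s' <= s} by apply: mem_rem.
have head_g : head c (p ++ [:: c; u]) = head c p by case: (p).
have alt_g : alt (p ++ [:: c; u]) by rewrite alt_cat //= eqxx.
have path_g : sorted (frel f) (p ++ [:: c; u]).
  by rewrite sorted_cat_cons pathp /= fc eqxx.
have min_g : all (fun y => (head c p <= y)%N) (p ++ [:: c; u]).
  by rewrite -cat_rcons all_cat min_p /= ltnW // (allP min_s).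
have sort_s' : sorted ltv s' by apply: (subseq_sorted ltv_trans (rem_subseq _ _)).
case: ifP ex => [fuD ex|_ /andP[fus ex]]; last first.
  have pt := perm_to_rem fus.
  have head_gt : head (f u) (p ++ [:: c; u]) = head c p by case: (p).
  apply: (IH (p ++ [:: c; u]) _ _ _ _ ex gd altgs DE); rewrite ?head_gt //.
  - by rewrite -cats1 -catA sorted_cat_cons pathp /= fc !eqxx.
  - apply: perm_trans permg; rewrite -cats1 -!catA !perm_cat2l /=.
    by rewrite -cat_cons perm_cat2r perm_sym.
  - by rewrite all_rcons min_g ltnW // (allP min_s) // sub_s.
  - by apply/allP => x /mem_rem/sub_s/(allP min_s).
  - exact: (subseq_sorted ltv_trans (rem_subseq _ _)).
have gd' : good f ((p ++ [:: c; u]) :: gs).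
  apply: (@good_cons c) => //; rewrite ?head_g //.
  - by case: (p).
  - by rewrite last_cat /= -DE.
  - by move: usg; rewrite uniq_catCA cat_uniq => /and3P[_ _].
  - by apply/allP => x xg; rewrite memVg mem_cat xg.
case def_s': s' ex => [|m s''] ex.
  exists ((p ++ [:: c; u]) :: gs); split=> //=; first by rewrite alt_g.
  by move=> x; rewrite [RHS]memVg def_s'.
rewrite -def_s' in ex; have ms' : m \in s' by rewrite def_s' mem_head.
have lt_m : (head c p < m)%N by rewrite (allP min_s) // sub_s.
apply: (IH [::] _ _ _ _ ex gd') => //=.
- by rewrite alt_g.
- move=> x; have: x \in s' -> x \notin (p ++ [:: c; u]) ++ flatten gs.
    move=> xs'; apply/negP => xg; move: usg; rewrite uniq_catCA cat_uniq.
    by case/and3P => _ /hasPn/(_ _ xg); rewrite /= xs'.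
  rewrite in_set inRE memVg !mem_cat.
  by case: (x \in p) (x \in [:: c; u]) (x \in s') (x \in flatten gs)
    => [] [] [] [] //= /(_ isT).
- by rewrite -cat_cons -def_s' perm_catCA.
- by rewrite leqnn.
- by move: sort_s'; rewrite def_s' => /(order_path_min ltv_trans).
- apply/andP; split; first by move: lt_m; case: (p).
  apply/allP => -[|y q] /(allP st) //=; move=> h; exact: ltn_trans h lt_m.
- by move: sort_s'; rewrite def_s' => /path_sorted.
Qed.

Lemma good_starts post g gs m q : g = m :: q -> good f (post ++ g :: gs) ->
  {in flatten post, forall x, (m < x)%N}.
Proof.
move=> ->; elim: post => //= -[|y q'] post IH //= /andP[].
case/and4P => _ /allP min_y /allP st _ /and3P[_ _ /IH {}IH] x.
rewrite -cat_cons mem_cat => /orP[|/IH //].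
have lt_m : (m < y)%N by apply: (st (m :: q)); rewrite mem_cat mem_head orbT.
by rewrite inE => /orP[/eqP -> //|/min_y]; apply: leq_trans.
Qed.

(** This identifies the start of a path with the smallest vertex unvisited when the exploration
    opens that path. *)
Lemma good_first post m q gs : good f (post ++ (m :: q) :: gs) ->
  {in flatten post ++ m :: q, forall x, (m <= x)%N}.
Proof.
move=> gd x; rewrite mem_cat => /orP[/(good_starts erefl gd)/ltnW //|].
rewrite inE => /orP[/eqP -> //|].
by have /andP[/and4P[_ /allP min_q _ _] _] := good_cat gd; apply: min_q.
Qed.

Lemma sorted_first m m' s : sorted ltv (m' :: s) -> m \in m' :: s ->
  {in m' :: s, forall x, (m <= x)%N} -> m' = m.
Proof.
move=> sort_s ms min_m; apply/val_inj/eqP.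
rewrite eqn_leq min_m ?mem_head // andbT.
move: ms; rewrite inE => /orP[/eqP -> //|ms].
by have /= lt_m := allP (order_path_min ltv_trans sort_s) _ ms; apply: ltnW.
Qed.

(** The exploration reads the list of paths from right to left. At [c], the paths of [gs] are
    finished and those of [post] not yet begun. *)
Lemma good_explore k p c q post gs (D : {set T}) s :
  good f (post ++ (p ++ c :: q) :: gs) ->
  flatten (post ++ (p ++ c :: q) :: gs) =i @inV n r ->
  all alt post -> alt (c :: q) ->
  (forall x, (x \in D) = inR x || (x \in flatten gs)) ->
  perm_eq s (q ++ flatten post) -> sorted ltv s -> (size s < k.*2)%N ->
  explore mate k f D c s.
Proof.
elim: k p c q post gs D s => // k IH p c q post gs D s gd gV alt_post alt_q DE perm_s sort_s.
move=> lt_s; case: q gd gV alt_q perm_s => // u q gd gV /andP[/eqP def_u alt_q] perm_s.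
have us_s : u \in s by rewrite (perm_mem perm_s) mem_head.
have gd_g := good_cat gd.
have pathg : sorted (frel f) (p ++ [:: c, u & q]).
  by case: (p) gd_g => [|m p'] /andP[/and4P[]].
have fc : f c = u by move: pathg; rewrite sorted_cat_cons => /and3P[_ /eqP].
rewrite /= -def_u fc eqxx /=.
have perm_s' : perm_eq (rem u s) (q ++ flatten post).
  by rewrite -(perm_cons u) perm_sym; apply: perm_trans (perm_to_rem us_s); rewrite perm_sym.
have sort_s' : sorted ltv (rem u s) by apply: (subseq_sorted ltv_trans (rem_subseq _ _)).
have lt_s' : (size (rem u s) < (k.*2).+1)%N.
  by rewrite size_rem //; move: lt_s; case: (size s) => //= a; rewrite doubleS !ltnS.
have gD x : x \in p ++ [:: c, u & q] -> x \notin D.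
  move=> xg; have xV : inV x.
    by apply: (good_inV gd_g); rewrite flatten_cons mem_cat xg.
  rewrite DE inRE xV /=.
  apply/negP => xgs; have := good_uniq gd_g; rewrite flatten_cons cat_uniq.
  by case/and3P => _ /hasPn/(_ _ xgs); rewrite /= xg.
clear perm_s gd_g; case: q gd gV alt_q perm_s' pathg gD => [|t q] gd gV alt_q perm_s' pathg gD.
  have fuD : f u \in D.
    rewrite DE; case: (p) gd => [|m p'] /good_cat/andP[/and4P[_ _ _]] /=; rewrite ?last_cat //.
  (* The next path is the last one of [post]; its start [m] is the smallest unvisited vertex, hence
     the head of the sorted list [rem u s]. *)
  rewrite fuD; case/lastP: post gd gV alt_post perm_s' => [|post g] gd gV alt_post perm_s'.
    by rewrite (size0nil (perm_size perm_s')).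
  rewrite all_rcons in alt_post; case/andP: alt_post => alt_g alt_post.
  rewrite cat_rcons in gd gV; have gd1 := good_cat gd.
  case: g gd gV gd1 alt_g perm_s' => [|m q] gd gV gd1 alt_g; first by case/andP: gd1.
  rewrite cat0s flatten_rcons => perm_s'.
  have memV x : inV x = (x \in rem u s) || (x \in flatten ((p ++ [:: c; u]) :: gs)).
    rewrite -[LHS]gV (perm_mem perm_s') flatten_cat mem_cat [flatten (_ :: _)]flatten_cons.
    by rewrite !mem_cat !orbA.
  have disj x : x \in rem u s -> x \notin flatten ((p ++ [:: c; u]) :: gs).
    rewrite (perm_mem perm_s') => xs'; apply/negP => xg; have := good_uniq gd.
    rewrite flatten_cat [flatten (_ :: _)]flatten_cons catA cat_uniq.
    by case/and3P => _ /hasPn/(_ _ xg); rewrite /= xs'.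
  have ms' : m \in rem u s by rewrite (perm_mem perm_s') mem_cat mem_head orbT.
  case def_s': (rem u s) ms' => [|m' s''] // ms'.
  rewrite -def_s'; have em : m' = m.
    apply: (@sorted_first m m' s'' _ ms'); rewrite -def_s' // => x.
    by rewrite (perm_mem perm_s'); apply: (good_first gd).
  rewrite em in def_s' *.
  apply: (IH [::] m q post ((p ++ [:: c; u]) :: gs)) => //.
  - move=> x; rewrite in_set inRE memV; have := disj x.
    by case: (x \in rem u s) => [/(_ isT)/negbTE ->|_] //=; rewrite orNb.
  - rewrite -(perm_cons m) -def_s' (perm_trans perm_s') //.
    by rewrite perm_catC /= perm_refl.
  - by move: sort_s'; rewrite def_s' => /path_sorted.
  - by move: lt_s'; rewrite def_s'.
have fu : f u = t.
  by move: pathg; rewrite (sorted_cat_cons _ p) => /and3P[_ _ /andP[/eqP]].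
have t_s : t \in rem u s by rewrite (perm_mem perm_s') mem_head.
rewrite fu (negbTE (gD t _)) ?t_s /=; last by rewrite mem_cat !inE eqxx !orbT.
apply: (IH (p ++ [:: c; u]) t q post gs) => //; rewrite -?catA //.
- by rewrite -(perm_cons t) perm_sym; apply: perm_trans (perm_to_rem t_s); rewrite perm_sym.
- exact: (subseq_sorted ltv_trans (rem_subseq _ _)).
- by rewrite size_rem //; move: lt_s'; case: (rem u s) t_s => //= z l _.
Qed.

End Alternation.

(** * Spanning forests as functions on vertices *)

Section Forests.
Variables (C : numFieldType) (n r : nat) (AR : 'M[C]_(n + r)).
Variable M0 : {set {set 'I_(n + r)}}.
Local Notation T := 'I_(n + r).
Implicit Types (u v w x y : T) (f : {ffun T -> T}).
Hypothesis pm : perfect_matching AR M0.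
Hypothesis askew : forall x y, AR x y = - AR y x.

Definition mate v : T := odflt v [pick w | [set v; w] \in M0].

Lemma matching_edge e : e \in M0 ->
  exists i j, [/\ e = [set i; j], inV i, inV j & adj AR i j].
Proof.
case/andP: pm => /forallP /(_ e) /implyP h _ /h /existsP[i /existsP[j]].
by case/and4P => /eqP -> iV jV a_ij; exists i, j.
Qed.

Lemma mate_edge v : inV v -> [set v; mate v] \in M0.
Proof.
move=> vV; rewrite /mate; case: pickP => //= none0.
have none w : ([set v; w] \in M0) = false := none0 w.
case/andP: pm => _ /forallP /(_ v) /implyP /(_ vV) /cards1P[e /setP /(_ e)].
rewrite !inE eqxx => /andP[eM ve]; have [i [j [def_e _ _ _]]] := matching_edge eM.
move: ve eM; rewrite def_e !inE => /orP[/eqP <-|/eqP <-]; first by rewrite none.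
by rewrite setUC none.
Qed.

Lemma edge_mate v w : [set v; w] \in M0 -> [/\ inV v, w = mate v & adj AR v w].
Proof.
have nloop x y : [set x; y] \in M0 -> [/\ inV x, x != y & adj AR x y].
  case/matching_edge => i [j [e iV jV a_ij]].
  have adjC : adj AR j i by move: a_ij; rewrite /adj eq_sym askew oppr_eq0.
  have nij : i != j by case/andP: a_ij.
  have nxy : x != y.
    by have := cards2 x y; rewrite e cards2 nij; case: (x != y).
  have xij : x \in [set i; j] by rewrite -e !inE eqxx.
  have yij : y \in [set i; j] by rewrite -e !inE eqxx orbT.
  move: xij yij nxy; rewrite !inE => /orP[/eqP ->|/eqP ->] /orP[/eqP ->|/eqP ->];
    by rewrite ?eqxx.
move=> e; have [vV vw a_vw] := nloop _ _ e; split=> //.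
have [_ vm _] := nloop _ _ (mate_edge vV).
case/andP: pm => _ /forallP /(_ v) /implyP /(_ vV) /cards1P[e0 /setP e0P].
have := e0P [set v; w]; have := e0P [set v; mate v]; rewrite !inE e mate_edge // !eqxx /=.
move/esym/eqP => <- /esym/eqP/setP /(_ w); rewrite !inE eqxx orbT.
by rewrite eq_sym (negbTE vw) => /esym/eqP.
Qed.

Lemma mateV v : inV v -> inV (mate v).
Proof. by move/mate_edge; rewrite setUC => /edge_mate[]. Qed.

Lemma mate_neq v : inV v -> mate v != v.
Proof. by move/mate_edge/edge_mate => [_ _ /andP[]]; rewrite eq_sym. Qed.

Lemma mateK v : inV v -> mate (mate v) = v.
Proof. by move/mate_edge; rewrite setUC => /edge_mate[]. Qed.

Lemma in_M_mate v w : inV v -> in_M M0 (v, w) = (w == mate v).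
Proof.
move=> vV; apply/idP/eqP => [/edge_mate[]//|->]; exact: mate_edge.
Qed.

Definition graph f : {set T * T} := edge_set f (enum (@inV n r)).

Lemma in_graph f u v : ((u, v) \in graph f) = inV u && (v == f u).
Proof. by rewrite inE mem_enum. Qed.

(** Common description of the forests with Condition (C) and of the successful explorations; that
    the pairs [(v, f v)] are edges of the graph is kept apart. *)
Definition alternating f :=
  exists gs, [/\ good f gs, all (alt mate) gs & flatten gs =i @inV n r].

Lemma graph_flatten f gs : flatten gs =i @inV n r -> edge_set f (flatten gs) = graph f.
Proof. by move=> gsV; apply/setP => p; rewrite !inE mem_enum gsV. Qed.

(** Exactly one end of each matching edge is its tail: two would form a cycle, against [good_index],
    and the grouping in pairs provides one. *)
Lemma alternating_tail f v : alternating f -> inV v ->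
  (f (mate v) == v) = (f v != mate v).
Proof.
case=> gs [gd altgs gsV] vV; have v_gs : v \in flatten gs by rewrite gsV.
have mv_gs : mate v \in flatten gs by rewrite gsV; apply: mateV.
apply/idP/idP => [/eqP fm|].
  apply/negP => /eqP fv; have := good_index gd v_gs; have := good_index gd mv_gs.
  by rewrite fm fv => /ltnW; rewrite leqNgt => /negbTE ->.
apply: contraR => nfm; have {gsV mv_gs} : all (@inV n r) (flatten gs).
  by apply/allP => x; rewrite gsV.
elim: gs gd altgs v_gs => //= g gs IH /and4P[gP _ _ gd] /andP[altg altgs].
rewrite mem_cat all_cat => vin /andP[gV gsV]; case/orP: vin => [vg|]; last by move/IH => ->.
have {gP}: sorted (frel f) g by case: (g) gP => // m q /and4P[].
have [N] := ubnP (size g); elim: N g altg gV vg => // N IHN [|x [|y g]] //=.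
case/andP=> /eqP -> altg /and3P[xV _ gV] vin lt_N /andP[/eqP fx pg].
move: vin; rewrite !inE => /or3P[/eqP ->|/eqP ev|vg].
- by rewrite fx.
- by move: nfm; rewrite ev mateK // fx eqxx.
- by apply: (IHN g) => //; [apply: ltnW lt_N | apply: path_sorted pg].
Qed.

(** If [f v] is not [mate v], then [mate v] is a tail and the entry at [v] and [f v] is a factor of
    the weight. *)
Lemma alternating_adj h f v : alternating f -> inV v ->
  weight (@inV n r) mate (fun x y => AR x y) h f != 0 -> adj AR v (f v).
Proof.
move=> af vV; rewrite /weight mulf_eq0 => /norP[_ /prodf_neq0 nz].
case: (altP (f v =P mate v)) => [->|nfv]; first by have [] := edge_mate (mate_edge vV).
have := nz (mate v); rewrite /tail_of mateV // mateK // alternating_tail // => /(_ nfv) a_nz.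
rewrite /adj a_nz andbT; case: af => gs [gd _ gsV].
have v_gs : v \in flatten gs by rewrite gsV.
by apply: contraTneq (good_index gd v_gs) => <-; rewrite ltnn.
Qed.

Lemma alternating_forest f : alternating f ->
  (forall v, inV v -> adj AR v (f v)) ->
  [&& spanning_forest AR (graph f), compatible M0 (graph f) & condC M0 (graph f)].
Proof.
move=> af adjf; case: (af) => gs [gd altgs gsV]; apply/and3P; split.
- apply/and3P; split.
  + apply/forall_inP => -[u v]; rewrite in_graph => /andP[uV /eqP ->]; exact: adjf.
  + apply/forallP => v; case: ifP => vV.
      rewrite (_ : out_edges _ _ = [set (v, f v)]) ?cards1 //.
      apply/setP => -[u w]; rewrite in_set in_graph in_set1 xpair_eqE /=.
      by case: (u =P v) => [->|]; rewrite ?vV ?andbT ?andbF.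
    rewrite cards_eq0; apply/eqP/setP => -[u w]; rewrite in_set in_graph in_set0 /=.
    by case: (u =P v) => [->|]; rewrite ?vV ?andbF.
  + by apply/forall_inP; rewrite -(graph_flatten f gsV); apply: edge_set_index.
- apply/forall_inP => e eM; have [i [j [def_e iV jV _]]] := matching_edge eM.
  have [_ def_j _] : [/\ inV i, j = mate i & adj AR i j] by apply: edge_mate; rewrite -def_e.
  apply/exists_inP; case: (boolP (f i == mate i)) => [/eqP fi|].
    by exists (i, f i); rewrite ?in_graph ?iV ?eqxx //= fi -def_j def_e.
  rewrite -alternating_tail // -def_j => /eqP fj.
  by exists (j, f j); rewrite ?in_graph ?jV ?eqxx //= fj setUC def_e.
rewrite /condC -(graph_flatten f gsV) trim_good //; last first.
  by rewrite -(card_uniqP (good_uniq gd)) max_card.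
rewrite all_map; apply/allP => g ggs /=; rewrite size_map (alt_odd (allP altgs g ggs)).
have: sorted (frel f) g /\ all (@inV n r) g /\ g != [::].
  elim: (gs) gd ggs => //= g' gs' IH /and4P[gP _ gV gd].
  rewrite inE => /orP[/eqP ->|/(IH gd) //].
  by case: (g') gP gV => // m q /and4P[].
move: (allP altgs g ggs) => {ggs}; case: g => [|x [|y g]] //=; first by move=> _ [_ []].
by case/andP => /eqP -> _ [/andP[/eqP fx _] [/andP[xV _] _]]; rewrite in_M_mate // fx.
Qed.

(** [good_extend] builds the trimmed paths; compatibility and the even lengths in Condition (C) make
    them alternate. *)
Lemma forest_alternating f : (forall v, ~~ inV v -> f v = v) ->
  spanning_forest AR (graph f) -> compatible M0 (graph f) -> condC M0 (graph f) ->
  alternating f.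
Proof.
move=> fR /and3P[_ _ acyc] compat cC.
(* Otherwise the orbit of [v] stays in [V] and, being finite, contains a cycle of the graph. *)
have reach v : exists k, inR (iter k f v).
  case: (boolP [exists k : 'I_(fingraph.order f v), inR (iter k f v)]) => [/existsP[k kR]|].
    by exists k.
  rewrite negb_exists => /forallP noR.
  have itV k : inV (iter k f v).
    have := looping_order f v => /loopingP/(_ k)/trajectP[i lt_i ->].
    by have := noR (Ordinal lt_i); rewrite inRE negbK.
  have /trajectP[i lt_i e] := looping_order f v.
  have con k : connect [rel u w | (u, w) \in graph f] (f (iter i f v)) (iter (i.+1 + k) f v).
    elim: k => [|k IHk]; first by rewrite addn0 connect0.
    apply: connect_trans IHk (connect1 _).
    by rewrite addnS /= inE mem_enum /= eqxx andbT; exact: (itV (i.+1 + k)%N).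
  have := forall_inP acyc (iter i f v, f (iter i f v)).
  rewrite in_graph eqxx andbT => /(_ (itV i)) /=.
  by have := con (fingraph.order f v - i.+1)%N; rewrite subnKC // e => ->.
have [//|//|gs gd gsV] := @good_extend n r f [::] reach.
exists gs; split=> //; apply: (good_alt mateV mateK gd gsV).
  move=> v vV; have /exists_inP[[x y]] := forall_inP compat _ (mate_edge vV).
  rewrite in_graph /= => /andP[xV /eqP ->] /eqP e.
  have : [set x; f x] \in M0 by rewrite e mate_edge.
  case/edge_mate => _ fx _; have : v \in [set x; f x] by rewrite e !inE eqxx.
  by rewrite !inE => /orP[/eqP ->|/eqP ->]; [left|right; rewrite fx mateK].
move: cC; rewrite /condC -(graph_flatten f gsV) trim_good //; last first.
  by rewrite -(card_uniqP (good_uniq gd)) max_card.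
by rewrite all_map => /allP h; apply/allP => g /h /=; rewrite size_map => /andP[].
Qed.

Lemma explore_alternating k m s f :
  m :: s =i @inV n r -> sorted (fun x y : T => x < y)%N (m :: s) ->
  (size s < k.*2)%N ->
  explore mate k f [set x | inR x] m s <-> alternating f.
Proof.
move=> sV sort_s lt_s; have us : uniq (m :: s).
  by apply: sorted_uniq sort_s; [apply: ltv_trans|move=> x; apply: ltnn].
split=> [ex|[gs [gd altgs gsV]]].
  have min_m := order_path_min (@ltv_trans n r) sort_s.
  apply: (explore_good mateV mate_neq mateK (p := [::]) (gs := [::]) ex) => //=.
  - by move=> x; rewrite inE orbF.
  - by rewrite cats0; apply: uniq_perm (enum_uniq _) _ => // x; rewrite mem_enum sV.
  - by rewrite leqnn.
  - exact: path_sorted sort_s.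
have perm_s : perm_eq (m :: s) (flatten gs).
  by apply: uniq_perm => // [|x]; [apply: good_uniq gd | rewrite sV gsV].
case/lastP: gs gd altgs gsV perm_s => [|post g] gd altgs gsV perm_s.
  by have := perm_size perm_s.
rewrite -cats1 in gd gsV perm_s.
case: g gd altgs gsV perm_s => [|m' q] gd altgs gsV perm_s.
  by have /andP[] := good_cat gd.
have def_flat : flatten (post ++ [:: m' :: q]) = flatten post ++ m' :: q.
  by rewrite flatten_cat /= cats0.
have em : m' = m.
  apply/esym; apply: (sorted_first sort_s).
    by rewrite (perm_mem perm_s) def_flat mem_cat mem_head orbT.
  by move=> x; rewrite (perm_mem perm_s) def_flat; apply: (good_first gd).
rewrite em {m' em} in gd altgs gsV perm_s def_flat.
move: altgs; rewrite all_rcons => /andP[altg altpost].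
apply: (good_explore (p := [::]) (post := post) gd gsV) => //.
- by move=> x; rewrite inE orbF.
- rewrite -(perm_cons m) (perm_trans perm_s) // def_flat.
  by rewrite perm_catC /= perm_refl.
- exact: path_sorted sort_s.
Qed.

(** * Signs and weights of forests *)

Definition nonroot_seq : seq T := [seq lshift r i | i <- enum 'I_n].
Definition root_seq : seq T := [seq rshift n i | i <- enum 'I_r].

Lemma enum_split : enum T = nonroot_seq ++ root_seq.
Proof.
have valE k : map (@nat_of_ord k) (enum 'I_k) = iota 0 k := val_enum_ord k.
apply: (inj_map (@ord_inj (n + r))); rewrite /nonroot_seq /root_seq map_cat valE iotaD.
rewrite -(map_comp _ (@lshift n r)) -(map_comp _ (@rshift n r)).
congr (_ ++ _); first by rewrite -valE; apply: eq_map.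
by rewrite add0n -[n in iota n]addn0 iotaDl -valE -(map_comp (addn n)); apply: eq_map.
Qed.

Lemma mem_nonroot : nonroot_seq =i @inV n r.
Proof.
move=> x; apply/mapP/idP => [[i _ ->]|xV]; first by rewrite unfold_in /inV /= ltn_ord.
by exists (Ordinal xV); rewrite ?mem_enum //; apply: val_inj.
Qed.

Lemma mem_nonrootE x : (x \in nonroot_seq) = inV x.
Proof. exact: mem_nonroot. Qed.

Lemma nonroot_sorted : sorted (fun x y : T => x < y)%N nonroot_seq.
Proof.
rewrite -[sorted _ _]/(sorted (relpre (@nat_of_ord (n + r)) ltn) _) -sorted_map -map_comp.
have -> : map (@nat_of_ord (n + r) \o @lshift n r) (enum 'I_n) = map val (enum 'I_n) by [].
by rewrite val_enum_ord iota_ltn_sorted.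
Qed.

(** Appending the roots in order lists a permutation of all vertices that fixes the roots, which
    does not affect its sign. *)
Definition sgn_nonroot (l : seq T) : C := lsgn C (l ++ root_seq).

Lemma sgn_nonroot_swapping : swapping sgn_nonroot.
Proof. by move=> p x y q; rewrite /sgn_nonroot -!catA; apply: lsgn_swapping. Qed.

Lemma sgn_nonroot1 : sgn_nonroot nonroot_seq = 1.
Proof.
have := lsgn_perm C (1%g : 'S_(n + r)); rewrite odd_perm1 expr0 => <-.
rewrite /sgn_nonroot -enum_split -{1}[enum _]map_id.
by congr lsgn; apply: eq_map => i; rewrite perm1.
Qed.

Definition edge_tails f : seq T :=
  [seq p.1 | p <- enum [set p in graph f | in_M M0 p]].

Lemma mem_tail_edges f u v :
  ((u, v) \in enum [set p in graph f | in_M M0 p])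
  = tail_of (@inV n r) mate f u && (v == f u).
Proof.
rewrite mem_enum in_set in_graph /tail_of; case: (v =P f u) => [->|_]; last by rewrite !andbF.
by rewrite !andbT; case: (boolP (inV u)) => //= uV; rewrite in_M_mate.
Qed.

Lemma match_seq_pairs f : match_seq M0 (graph f) = pairs mate (edge_tails f).
Proof.
rewrite /match_seq /pairs /edge_tails -map_comp; congr flatten.
apply/eq_in_map => -[u v]; rewrite mem_tail_edges /=.
by case/andP => /andP[_ /eqP fu] /eqP ->; rewrite fu.
Qed.

Lemma edge_tails_perm f : perm_eq (edge_tails f) (enum (tail_of (@inV n r) mate f)).
Proof.
apply: uniq_perm => [||v].
- rewrite map_inj_in_uniq ?enum_uniq // => -[u v] [u' v'].
  by rewrite !mem_tail_edges => /andP[_ /eqP ->] /andP[_ /eqP ->] /= ->.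
- exact: enum_uniq.
rewrite [RHS]mem_enum; apply/mapP/idP => [[[u w]]|tv].
  by rewrite mem_tail_edges => /andP[tu _] ->.
by exists (v, f v) => //; rewrite mem_tail_edges eqxx andbT.
Qed.

Lemma pairs_tails f : alternating f ->
  perm_eq (pairs mate (edge_tails f) ++ root_seq) (enum T).
Proof.
move=> af; rewrite enum_split perm_cat2r.
have perm_t := edge_tails_perm f.
apply: perm_trans (perm_pairs _ perm_t) _.
have tailE v : (v \in enum (tail_of (@inV n r) mate f)) = inV v && (f v == mate v).
  by rewrite mem_enum.
have pairsE tl : uniq tl -> {in tl, forall v, inV v} ->
    {in tl, forall v, mate v \notin tl} -> uniq (pairs mate tl).
  elim: tl => //= x tl IH /andP[xtl utl] tV tm.
  have xV : inV x by apply: tV; apply: mem_head.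
  have sub v : v \in tl -> v \in x :: tl by rewrite inE orbC => ->.
  rewrite !inE negb_or eq_sym mate_neq //= mem_pairs negb_or xtl mem_pairs negb_or.
  rewrite IH ?andbT //.
  - have := tm x (mem_head _ _); rewrite inE negb_or => /andP[_ ->].
    apply/andP; split; apply/mapP => -[y ytl e].
      by have := tm y (sub y ytl); rewrite -e mem_head.
    by move: xtl; rewrite -[x]mateK // e mateK ?ytl // tV ?sub.
  - by move=> v /sub/tV.
  - by move=> v /sub/tm; rewrite inE negb_or => /andP[].
apply: uniq_perm => [||v].
- apply: pairsE (enum_uniq _) _ _ => v; rewrite tailE => /andP[vV fv] //.
  by rewrite tailE negb_and mateV // mateK // alternating_tail // fv.
- rewrite map_inj_uniq ?enum_uniq //; exact: lshift_inj.
rewrite mem_nonroot mem_pairs tailE -[RHS]/(inV v).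
apply/orP/idP => [[/andP[] //|/mapP[u]]|vV].
  by rewrite tailE => /andP[uV _] ->; apply: mateV.
case: (boolP (f v == mate v)) => fv; [by left; rewrite vV|right].
apply/mapP; exists (mate v); rewrite ?mateK // tailE mateV // mateK //=.
by rewrite alternating_tail.
Qed.

Lemma sgn_sigmaE f : alternating f ->
  sgn_sigma C M0 (graph f) = sgn_nonroot (pairs mate (edge_tails f)).
Proof.
move=> af; set L := pairs mate _.
have permL : perm_eq (L ++ root_seq) (enum T) := pairs_tails af.
have szL : size L = n.
  have := perm_size permL; rewrite enum_split !size_cat => /addIn ->.
  by rewrite size_map size_enum_ord.
have [s def_s] := @tuple_permP _ _ _ (ord_tuple (n + r)) permL.
have {}def_s : L ++ root_seq = map s (enum T).
  by rewrite def_s /=; apply: eq_map => i; rewrite tnth_ord_tuple.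
have sE x : sigma_fun M0 (graph f) x = s x.
  have nth_s : nth x (L ++ root_seq) x = s x.
    rewrite def_s (nth_map x) ?size_enum_ord ?ltn_ord //.
    by rewrite nth_ord_enum.
  rewrite /sigma_fun match_seq_pairs -nth_s nth_cat szL -/L /inV; case: ifP => // nx.
  case: (split_ordP x) nx => j -> // _ /=.
  by rewrite addKn (nth_map j) ?size_enum_ord // nth_ord_enum.
rewrite /sgn_sigma; case: pickP => [s' /forallP s'E|/(_ s)] /=; last first.
  by case/negP; apply/forallP => x; rewrite sE.
have -> : s' = s by apply/permP => x; rewrite -sE; apply/eqP.
by rewrite /sgn_nonroot def_s lsgn_perm.
Qed.

(** The two sides list the matching edges in different orders, which is harmless by [pairs_block].
    The other edges are indexed by the matching tails [v], as those leaving [mate v]. *)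
Lemma forest_term f : alternating f ->
  sgn_sigma C M0 (graph f) * \prod_(p in graph f | ~~ in_M M0 p) AR p.1 p.2
  = weight (@inV n r) mate (fun x y => AR x y) sgn_nonroot f.
Proof.
move=> af; rewrite sgn_sigmaE // /weight.
rewrite (pairs_block mate sgn_nonroot_swapping (edge_tails_perm f)); congr (_ * _).
rewrite (reindex_onto (fun v => (mate v, f (mate v))) (fun p => mate p.1)) /=.
  apply: eq_bigl => v; rewrite in_graph eqxx andbT /tail_of.
  case: (boolP (inV v)) => vV /=.
    rewrite mateV // mateK // eqxx in_M_mate ?mateV // mateK // andbT.
    by rewrite alternating_tail // negbK.
  case: (boolP (inV (mate v))) => //= mvV; case: (mate (mate v) =P v); rewrite ?andbF // => e.
  by rewrite -e mateV in vV.
case=> u v; rewrite in_graph /= => /andP[/andP[uV /eqP ->] _].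
by rewrite mateK.
Qed.

(** * The sum over forests *)

Definition target (F : {set T * T}) : {ffun T -> T} :=
  [ffun v => odflt v (omap snd [pick p in F | p.1 == v])].

Lemma targetK (F : {set T * T}) : spanning_forest AR F -> graph (target F) = F.
Proof.
case/and3P => _ /forallP out _; apply/setP => -[u v]; rewrite in_graph ffunE.
have := out u; case: ifP => uV /=.
  case/cards1P => p /setP outE; case: pickP => [[u' w] /= /andP[uwF /eqP eu]|none].
    have: (u', w) \in out_edges F u by rewrite in_set uwF eu eqxx.
    rewrite outE in_set1 => /eqP ep; rewrite -{p}ep eu in outE uwF *.
    have := outE (u, v); rewrite in_set in_set1 eqxx andbT => ->.
    by rewrite xpair_eqE eqxx.
  have := outE p; rewrite in_set1 eqxx in_set => e.
  by have := none p; rewrite /= e.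
rewrite cards_eq0 => /eqP/setP/(_ (u, v)); rewrite in_set in_set0 eqxx andbT => -> //.
Qed.

(** An edge set determines a function only on [V]; the default value in [target] singles out the one
    that is the identity on roots. *)
Lemma target_graph f : (target (graph f) == f) = agree_off nonroot_seq f [ffun x => x].
Proof.
have targetE v : target (graph f) v = if inV v then f v else v.
  rewrite ffunE; case: pickP => [[u w]|/(_ (v, f v))] /=.
    by rewrite in_graph => /andP[/andP[uV /eqP ->] /eqP <-]; rewrite uV.
  by rewrite in_graph !eqxx !andbT => ->.
apply/eqP/agree_offP => [e x|H].
  by rewrite mem_nonrootE ffunE -{1}e targetE => /negbTE ->.
apply/ffunP => x; rewrite targetE; case: ifP => // nx.
by rewrite H ?ffunE // mem_nonrootE nx.
Qed.

Hypothesis row_sum0 : forall x, \sum_y AR x y = 0.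

Lemma forest_sum : ~~ odd n -> (0 < n)%N ->
  pf (fun x y => AR x y) n./2 nonroot_seq =
  \sum_(F : {set T * T} |
          [&& spanning_forest AR F, compatible M0 F & condC M0 F])
     sgn_sigma C M0 F * \prod_(p in F | ~~ in_M M0 p) AR p.1 p.2.
Proof.
move=> even_n n_gt0.
(* The exploration starts at one vertex with [k.*2.+1] others unvisited. *)
have [k def_n] : exists k, n = k.+1.*2.
  exists (n./2).-1; rewrite prednK; last by case: (n) n_gt0 even_n => [|[]].
  by rewrite -[LHS]odd_double_half (negbTE even_n).
have : size nonroot_seq = n by rewrite size_map size_enum_ord.
case def_w: nonroot_seq => [|m s] /=; first by move=> n0; rewrite -n0 in n_gt0.
rewrite [in X in _ = X -> _]def_n => -[size_s].
have sV : m :: s =i @inV n r by move=> x; rewrite -def_w mem_nonroot.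
have us : uniq (m :: s).
  by rewrite -def_w map_inj_uniq ?enum_uniq //; apply: lshift_inj.
have half : n./2 = k.+1 by rewrite [in LHS]def_n doubleK.
have sVE x : (x \in m :: s) = inV x by rewrite -def_w mem_nonrootE.
have Ds : {in [set x : T | inR x], forall x, x \notin m :: s}.
  by move=> x; rewrite in_set inRE sVE.
pose id_f : {ffun T -> T} := [ffun x => x].
have tl0 v : v \in [::] -> id_f v = mate v /\ id_f (mate v) != v by [].
have := explore_sum mateV mate_neq mateK askew row_sum0 sgn_nonroot_swapping
  (tl := [::]) us sV Ds size_s tl0.
rewrite big_nil mulr1 /= -def_w sgn_nonroot1 mul1r half.
(* The current path is [m] alone, the only vertex neither a root nor in [s]. *)
have -> : pfrow (fun x y => AR x y) (fun y =>
      \sum_(p | (p \notin [set x | inR x]) && (p \notin s)) AR p y) k s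
  = pf (fun x y => AR x y) k.+1 (m :: s).
  apply: eq_altsum => y l; congr (_ * _); rewrite (big_pred1 m) // => p /=.
  rewrite in_set inRE negbK -sVE inE.
  by case: (p =P m) => [->|_] /=; [case/andP: us | rewrite andbN].
rewrite def_w => <-; set ex := explore mate k.+1.
pose P (f : {ffun T -> T}) :=
  [&& spanning_forest AR (graph f), compatible M0 (graph f) & condC M0 (graph f)].
have exE f : ex f [set x | inR x] m s <-> alternating f.
  apply: explore_alternating => //; first by rewrite -def_w nonroot_sorted.
  by rewrite size_s doubleS.
have PE f : agree_off nonroot_seq f id_f -> P f -> alternating f.
  move=> /agree_offP fid /and3P[]; apply: forest_alternating => v vR.
  by rewrite fid ?ffunE // mem_nonrootE.
rewrite [RHS](reindex_onto graph target) => [|F /and3P[]]; last by move/targetK.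
(* An exploration may use a pair that is no edge of the graph; a zero entry then makes its weight
   vanish. *)
rewrite (bigID P) /= [X in _ + X]big1 ?addr0 => [|f]; last first.
  case/andP => /andP[_ /exE af]; apply: contraNeq => nz.
  by apply: alternating_forest => // v vV; apply: alternating_adj nz.
apply: eq_big => [f|f /andP[/andP[_ /exE af] _]]; last by rewrite forest_term.
rewrite target_graph -def_w -/(P f) -/id_f; apply/andP/andP.
  by case=> /andP[-> _] ->.
case=> Pf fid; rewrite fid Pf; split=> //; apply/exE; exact: PE.
Qed.

End Forests.

Theorem theorem1 (C : numClosedFieldType) (n r : nat)
    (AR : 'M[C]_(n + r)) (M0 : {set {set 'I_(n + r)}}) :
  (2 <= n)%N -> ~~ odd n -> (1 <= r)%N ->
  AR^T = - AR ->
  (forall j, \sum_i AR i j = 0) ->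
  perfect_matching AR M0 ->
  pfaffian (ulsubmx AR) =
  \sum_(F : {set 'I_(n + r) * 'I_(n + r)} |
          [&& spanning_forest AR F, compatible M0 F & condC M0 F])
     sgn_sigma C M0 F * \prod_(p in F | ~~ in_M M0 p) AR p.1 p.2.
Proof.
move=> n_ge2 even_n _ ARskew col_sum0 pm.
have askew x y : AR x y = - AR y x.
  by have := congr1 (fun A : 'M_(n + r) => A y x) ARskew; rewrite !mxE.
have row_sum0 x : \sum_y AR x y = 0.
  apply/eqP; rewrite -oppr_eq0 -sumrN -[X in _ == X](col_sum0 x); apply/eqP.
  by apply: eq_bigr => y _; rewrite -askew.
rewrite -(forest_sum pm askew row_sum0 even_n (ltnW n_ge2)) /nonroot_seq pf_map.
rewrite pfaffian_pf // => [|i j]; last by rewrite !mxE askew.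
by apply: eq_pf => i j; rewrite !mxE.
Qed.
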